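(* Let $\mathcal{G}$ be the Grigorchuk group. For each $n\ge 5$, the product replacement graph $\Gamma_n(\mathcal{G})$ has exponential growth.
   Context: Let $\mathbf{T}=\{0,1\}^*$ be the rooted binary tree of finite binary strings. Let $a$ be the automorphism flipping the first bit of a string. Define automorphisms $b,c,d$ by: each fixes every string $1^n$, and for $n\ge0$ and any string $s$, each maps $1^n0s$ either to $1^n0s$ or to $1^n0a(s)$, where $d$ applies $a$ to $s$ iff $n\equiv 1,2\pmod 3$, $c$ iff $n\equiv 0,2\pmod 3$, and $b$ iff $n\equiv 0,1\pmod 3$. The Grigorchuk group is $\mathcal{G}=\langle a,b,c,d\rangle$. For a group $G$, a generating $n$-tuple is $(g_1,\dots,g_n)\in G^n$ generating $G$; the product replacement graph $\Gamma_n(G)$ has the generating $n$-tuples as vertices, with edges from $(g_1,\dots,g_n)$ to the tuples obtained by replacing $g_j$ with $g_jg_i^{\pm1}$ or $g_i^{\pm1}g_j$, for all ordered pairs $i\neq j$. For a graph $\Gamma$ and vertex $v$, $B_\Gamma(v,r)$ is the set of vertices at path distance at most $r$ from $v$; $\Gamma$ has exponential growth from $v$ if there is $\alpha>1$ with $|B_\Gamma(v,r)|\ge\alpha^r$ for all sufficiently large $r$. A graph has exponential growth if it is connected and has exponential growth from some (equivalently every) vertex. *)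

(* Defs.v *)
From Stdlib Require Import Reals List Arith Lia.
Import ListNotations.
Open Scope R_scope.

(* Vertices of the rooted binary tree T = {0,1}^*: bit 1 = true, bit 0 = false.
   The head of the list is the first bit. *)
Definition vtx := list bool.
Definition tfun := vtx -> vtx.

Definition ga (s : vtx) : vtx :=
  match s with [] => [] | x :: s' => negb x :: s' end.

Fixpoint gbcd (p : nat -> bool) (k : nat) (s : vtx) : vtx :=
  match s with
  | [] => []
  | true :: s' => true :: gbcd p (S k) s'
  | false :: s' => false :: (if p k then ga s' else s')
  end.

Definition pd (k : nat) : bool := negb (Nat.eqb (k mod 3) 0).
Definition pc (k : nat) : bool := negb (Nat.eqb (k mod 3) 1).
Definition pb (k : nat) : bool := negb (Nat.eqb (k mod 3) 2).

Definition gb : tfun := gbcd pb 0.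
Definition gc : tfun := gbcd pc 0.
Definition gd : tfun := gbcd pd 0.

Definition inverse_of (g f : tfun) : Prop :=
  (forall x, g (f x) = x) /\ (forall x, f (g x) = x).

Inductive gclos (S : list tfun) : tfun -> Prop :=
| gc_id : gclos S (fun x => x)
| gc_gen : forall f, In f S -> gclos S f
| gc_mul : forall f g, gclos S f -> gclos S g -> gclos S (fun x => f (g x))
| gc_inv : forall f g, gclos S f -> inverse_of g f -> gclos S g.

Definition Grig : tfun -> Prop := gclos [ga; gb; gc; gd].

Definition gen_tuple (n : nat) (v : list tfun) : Prop :=
  length v = n /\ forall f, gclos v f <-> Grig f.

Fixpoint upd (v : list tfun) (j : nat) (x : tfun) : list tfun :=
  match v, j with
  | [], _ => []
  | _ :: v', O => x :: v'
  | y :: v', S j' => y :: upd v' j' x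
  end.

Definition pr_edge (n : nat) (v w : list tfun) : Prop :=
  exists i j, (i < n)%nat /\ (j < n)%nat /\ i <> j /\
  exists h, (h = nth i v (fun x => x) \/ inverse_of h (nth i v (fun x => x))) /\
    (w = upd v j (fun x => nth j v (fun y => y) (h x)) \/
     w = upd v j (fun x => h (nth j v (fun y => y) x))).

Inductive walk (n : nat) (v : list tfun) : list tfun -> nat -> Prop :=
| walk0 : walk n v v 0
| walkS : forall u w k, walk n v u k -> pr_edge n u w -> gen_tuple n w ->
    walk n v w (S k).

Definition ball (n : nat) (v : list tfun) (r : nat) (w : list tfun) : Prop :=
  gen_tuple n w /\ exists k, (k <= r)%nat /\ walk n v w k.

Definition connected_PR (n : nat) : Prop :=
  forall v w, gen_tuple n v -> gen_tuple n w -> exists k, walk n v w k.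

(* |B(v,r)| >= x  (balls are finite, so this is witnessed by a duplicate-free list) *)
Definition ball_card_ge (n : nat) (v : list tfun) (r : nat) (x : R) : Prop :=
  exists l : list (list tfun), NoDup l /\ (forall w, In w l -> ball n v r w) /\
    x <= INR (length l).

Definition exp_growth_from (n : nat) (v : list tfun) : Prop :=
  exists alpha : R, 1 < alpha /\ exists r0 : nat, forall r : nat, (r0 <= r)%nat ->
    ball_card_ge n v r (alpha ^ r).

Definition PR_exp_growth (n : nat) : Prop :=
  connected_PR n /\ exists v, gen_tuple n v /\ exp_growth_from n v.

(* Main.v *)
Require Import Defs.
From Stdlib Require Import Reals List Arith Bool Lia Lra Btauto Setoid Morphisms FunctionalExtensionality.
Import ListNotations.
Local Open Scope nat_scope.

(* Connectivity. By a theorem of Pervova, a subgroup H of G that surjects onto the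
   abelianization F_2^3 is G. Hence an entry of a generating tuple is redundant as soon as three
   other entries have independent classes, and with at least 4 entries every tuple can be moved
   to (a, c, d, 1, ..., 1).
   Pervova's theorem. The section subgroup of H at a child of the root again surjects onto
   F_2^3, and if it is G then H = G: N = {s : (1, s) in H} is normal and contains an element of
   the class of b, so by branching it contains the normal closure of (ab)^2 placed at all vertices
   of level 4; an induction on the level finishes. So H may be replaced by section subgroups.
   Sections of elements of H shrink until H contains a conjugate of one, and then of two, of
   b, c, d, hence also one of a. In the Bass-Serre tree of <a> * {1,b,c,d} the distances between
   the vertices fixed by these three do not increase under sections, and decrease when the
   letter d occurs, until H contains generators of G.
   Growth. An entry y is set to the element (ab)^2 placed at the vertex 1^t, in O(2^t) moves, and
   then conjugated along a Hamiltonian path of level t, while an entry w is or is not multiplied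
   by y at each of the 2^t steps. The conjugates of y have disjoint supports, so O(2^t) moves
   reach 2^(2^t) values of w. *)

(** * Words in a, b, c, d *)

(** Elements are handled as words modulo [==], because the quantities that shrink (the length, the
    number of letters other than a) belong to words; words become functions only when the graph
    enters. The obstacle in Pervova's theorem is that the two sections of an element are not
    independent: the recursion for b, c, d ties them together through a dihedral quotient of order
    8. Full section subgroups therefore only make the first level stabilizer of H a subdirect
    product, and what must be recovered is the subgroup of sections at bit 1 whose partner at bit 0
    is trivial. The normal closure of (ab)^2 has quotient C_2 x D, with D dihedral of order 8, in
    which only a central commutator is invisible in F_2^3; this is why containing that closure is
    enough. No finiteness of the index of H is known in advance, so every reduction has to work for
    arbitrary subgroups that surject onto F_2^3. *)

Inductive gen := La | Lb | Lc | Ld.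
Definition word := list gen.

Definition gen_act (x : gen) : tfun :=
  match x with La => ga | Lb => gb | Lc => gc | Ld => gd end.

Fixpoint eval (w : word) (s : vtx) : vtx :=
  match w with [] => s | x :: w' => gen_act x (eval w' s) end.

Definition weq (u v : word) : Prop := forall s, eval u s = eval v s.
Infix "==" := weq (at level 70).

(* [b = (a, c)], [c = (a, d)], [d = (1, b)]: [low] is the section at bit 0,
   [next] the section at bit 1. *)
Definition low (x : gen) : word :=
  match x with Lb | Lc => [La] | _ => [] end.
Definition next (x : gen) : gen :=
  match x with La => La | Lb => Lc | Lc => Ld | Ld => Lb end.
Definition isA (x : gen) : bool := match x with La => true | _ => false end.
Definition gsec (x : gen) (e : bool) : word :=
  if isA x then [] else if e then [next x] else low x.

Fixpoint rt (w : word) : bool :=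
  match w with [] => false | x :: w' => xorb (isA x) (rt w') end.
Fixpoint sec (w : word) (e : bool) : word :=
  match w with [] => [] | x :: w' => gsec x (xorb e (rt w')) ++ sec w' e end.

Lemma gbcd_ext (p q : nat -> bool) (i j : nat) (s : vtx) :
  (forall k, p (i + k) = q (j + k)) -> gbcd p i s = gbcd q j s.
Proof.
  revert i j; induction s as [|[] s IH]; intros i j H; simpl; auto.
  - f_equal. apply IH. intros k. rewrite !Nat.add_succ_l, <- !Nat.add_succ_r. apply H.
  - specialize (H 0). rewrite !Nat.add_0_r in H. now rewrite H.
Qed.

(** Shifting k rotates the three patterns [pb], [pc], [pd], which is the source of the recursion b
    -> c -> d -> b at bit 1. *)
Lemma mod3_shift (k r : nat) :
  (r < 3)%nat -> Nat.eqb (S k mod 3) r = Nat.eqb (k mod 3) ((r + 2) mod 3).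
Proof.
  intros Hr. 
  assert (Hk : (k mod 3 < 3)%nat) by (apply Nat.mod_upper_bound; lia).
  replace (S k) with (k + 1)%nat by lia. rewrite Nat.Div0.add_mod.
  destruct (k mod 3) as [|[|[|m]]]; try lia; destruct r as [|[|[|m]]]; try lia; reflexivity.
Qed.

Lemma gen_act_cons (x : gen) (e : bool) (s : vtx) :
  gen_act x (e :: s) = xorb e (isA x) :: eval (gsec x e) s.
Proof.
  destruct x, e; try reflexivity; simpl; unfold gb, gc, gd; simpl; f_equal;
    apply gbcd_ext; intros k; simpl; unfold pb, pc, pd; rewrite mod3_shift; auto with arith.
Qed.

Lemma gen_act_nil (x : gen) : gen_act x [] = [].
Proof. now destruct x. Qed.

Lemma eval_nil (w : word) : eval w [] = [].
Proof. induction w as [|x w IH]; simpl; auto. rewrite IH. apply gen_act_nil. Qed.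

Lemma eval_app (u v : word) (s : vtx) : eval (u ++ v) s = eval u (eval v s).
Proof. induction u; simpl; congruence. Qed.

Lemma eval_cons (w : word) (e : bool) (s : vtx) :
  eval w (e :: s) = xorb e (rt w) :: eval (sec w e) s.
Proof.
  induction w as [|x w IH]; simpl.
  - now rewrite xorb_false_r.
  - rewrite IH, gen_act_cons, eval_app. f_equal. now destruct e, (rt w), (isA x).
Qed.

Lemma rt_app (u v : word) : rt (u ++ v) = xorb (rt u) (rt v).
Proof. induction u; simpl; [now destruct (rt v)|]. now rewrite IHu, xorb_assoc. Qed.

Lemma sec_app (u v : word) (e : bool) :
  sec (u ++ v) e = sec u (xorb e (rt v)) ++ sec v e.
Proof.
  induction u as [|x u IH]; simpl; auto.
  rewrite IH, rt_app, <- app_assoc. f_equal. f_equal. destruct e, (rt u), (rt v); auto.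
Qed.

Lemma rt_rev (w : word) : rt (rev w) = rt w.
Proof.
  induction w; simpl; auto. rewrite rt_app, IHw; simpl. now destruct (isA a), (rt w).
Qed.

Lemma sec_rev (w : word) (e : bool) : sec (rev w) e = rev (sec w (xorb e (rt w))).
Proof.
  revert e; induction w as [|x w IH]; intros e; simpl; auto.
  rewrite sec_app, rev_app_distr, IH; simpl. rewrite app_nil_r, xorb_false_r.
  destruct x, e, (rt w); simpl; reflexivity.
Qed.

#[export] Instance weq_equivalence : Equivalence weq.
Proof.
  split; [intros u s | intros u v H s | intros u v w H K s]; auto.
  now rewrite H.
Qed.

#[export] Instance app_proper : Proper (weq ==> weq ==> weq) (@app gen).
Proof. intros u u' H v v' K s. now rewrite !eval_app, K, H. Qed.

#[export] Instance cons_proper : Proper (eq ==> weq ==> weq) (@cons gen).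
Proof. intros x y -> v v' K s. simpl. now rewrite K. Qed.

Lemma weq_sec (u v : word) :
  u == v <-> rt u = rt v /\ forall e, sec u e == sec v e.
Proof.
  split.
  - intros H.
    assert (R : forall e s, xorb e (rt u) :: eval (sec u e) s = xorb e (rt v) :: eval (sec v e) s).
    { intros e s. rewrite <- !eval_cons. apply H. }
    split.
    + specialize (R false []). injection R as R _. now destruct (rt u), (rt v).
    + intros e s. specialize (R e s). now injection R.
  - intros [H K] [|e s]; [now rewrite !eval_nil|]. rewrite !eval_cons, H. f_equal. apply K.
Qed.

Lemma weq_rt (u v : word) : u == v -> rt u = rt v.
Proof. intros H. now apply weq_sec in H. Qed.

Lemma weq_secs (u v : word) (e : bool) : u == v -> sec u e == sec v e.
Proof. intros H. now apply weq_sec in H. Qed.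

Lemma weq_by_sec (u v : word) :
  rt u = rt v -> sec u false == sec v false -> sec u true == sec v true -> u == v.
Proof. intros H K L. apply weq_sec. split; auto. now intros []. Qed.

(** The four letters are treated together, since the sections of a square of a letter are empty or
    squares of letters again. *)
Lemma gen_sq (x : gen) : [x; x] == [].
Proof.
  intros s; revert x; induction s as [|e s IH]; intros x; [now rewrite !eval_nil|].
  rewrite !eval_cons.
  destruct x, e; simpl; f_equal; exact (IH La) || exact (IH Lb) || exact (IH Lc)
    || exact (IH Ld) || reflexivity.
Qed.

Lemma gen_sq_l (x : gen) (w : word) : x :: x :: w == w.
Proof. change (x :: x :: w) with ([x; x] ++ w). now rewrite gen_sq. Qed.

Lemma mul_rev (w : word) : w ++ rev w == [].
Proof.
  induction w as [|x w IH]; simpl; [reflexivity|].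
  rewrite app_assoc, IH. simpl. apply gen_sq.
Qed.

Lemma rev_mul (w : word) : rev w ++ w == [].
Proof. rewrite <- (rev_involutive w) at 2. apply mul_rev. Qed.

#[export] Instance rev_proper : Proper (weq ==> weq) (@rev gen).
Proof.
  intros u v H.
  transitivity (rev u ++ (v ++ rev v)); [now rewrite mul_rev, app_nil_r|].
  rewrite <- H at 1. now rewrite app_assoc, rev_mul.
Qed.

Lemma mul_rev_l (w u : word) : w ++ rev w ++ u == u.
Proof. now rewrite app_assoc, mul_rev. Qed.

Lemma rev_mul_l (w u : word) : rev w ++ w ++ u == u.
Proof. now rewrite app_assoc, rev_mul. Qed.

(** * The Klein four-group {1, b, c, d} and the word problem *)

Definition third (x y : gen) : gen :=
  match x, y with
  | Lb, Lc | Lc, Lb => Ld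
  | Lb, Ld | Ld, Lb => Lc
  | _, _ => Lb
  end.

Definition gen_eqb (x y : gen) : bool :=
  match x, y with La, La | Lb, Lb | Lc, Lc | Ld, Ld => true | _, _ => false end.

Lemma gen_eqb_eq (x y : gen) : gen_eqb x y = true <-> x = y.
Proof. now destruct x, y. Qed.

Lemma klein (x y : gen) :
  isA x = false -> isA y = false -> x <> y -> [x; y] == [third x y].
Proof.
  intros Hx Hy Hxy s; revert x y Hx Hy Hxy.
  induction s as [|e s IH]; intros x y Hx Hy Hxy; [now rewrite !eval_nil|].
  rewrite !eval_cons.
  pose proof (gen_sq La s) as Haa.
  assert (IH' : forall x y, isA x || isA y || gen_eqb x y = false ->
                  eval [x; y] s = eval [third x y] s).
  { intros u v Huv. apply IH; destruct u, v; try discriminate; reflexivity. }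
  destruct x, y; try discriminate; try congruence; destruct e; simpl; f_equal;
    first [ reflexivity | exact Haa | apply (IH' Lb Lc) | apply (IH' Lb Ld) | apply (IH' Lc Lb)
          | apply (IH' Lc Ld) | apply (IH' Ld Lb) | apply (IH' Ld Lc) ]; reflexivity.
Qed.

Definition push (x : gen) (w : word) : word :=
  match w with
  | [] => [x]
  | y :: w' =>
      if gen_eqb x y then w'
      else if isA x || isA y then x :: w else third x y :: w'
  end.

Lemma push_weq (x : gen) (w : word) : push x w == x :: w.
Proof.
  destruct w as [|y w]; simpl; [reflexivity|].
  destruct (gen_eqb x y) eqn:E.
  { apply gen_eqb_eq in E. subst y. symmetry. apply gen_sq_l. }
  destruct (isA x || isA y) eqn:F; [reflexivity|].
  apply orb_false_elim in F. destruct F as [F1 F2].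
  change (x :: y :: w) with ([x; y] ++ w). rewrite klein; auto; [reflexivity|].
  intros ->. now destruct y.
Qed.

Fixpoint reduce (w : word) : word :=
  match w with [] => [] | x :: w' => push x (reduce w') end.

Lemma reduce_weq (w : word) : reduce w == w.
Proof. induction w; simpl; [reflexivity|]. now rewrite push_weq, IHw. Qed.

(* Semi-decision of the word problem: reduce freely, then pass to both sections. *)
Fixpoint trivb (n : nat) (w : word) : bool :=
  match reduce w with
  | [] => true
  | w' => match n with
          | O => false
          | S n' => negb (rt w') && trivb n' (sec w' false) && trivb n' (sec w' true)
          end
  end.

Lemma trivb_sound (n : nat) (w : word) : trivb n w = true -> w == [].
Proof.
  revert w; induction n as [|n IH]; intros w H; simpl in H;
    transitivity (reduce w); try (symmetry; apply reduce_weq);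
    destruct (reduce w) as [|x u] eqn:E; try reflexivity; try discriminate.
  apply andb_prop in H. destruct H as [H H2].
  apply andb_prop in H. destruct H as [H0 H1].
  apply weq_by_sec; [|now apply IH|now apply IH].
  apply negb_true_iff in H0. exact H0.
Qed.

Lemma weq_of_mul_rev (u v : word) : u ++ rev v == [] -> u == v.
Proof.
  intros H. transitivity (u ++ rev v ++ v); [now rewrite rev_mul, app_nil_r|].
  now rewrite app_assoc, H.
Qed.

Lemma weq_check (n : nat) (u v : word) : trivb n (u ++ rev v) = true -> u == v.
Proof. intros H. apply weq_of_mul_rev. now apply (trivb_sound n). Qed.

Ltac word_eq := apply (weq_check 6); vm_compute; reflexivity.

Fixpoint q1 (w : word) : bool :=
  match w with [] => false | x :: w' => xorb (match x with Lb | Lc => true | _ => false end) (q1 w') end.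
(** With [rt] these are coordinates on the abelianization: (q1, q2) is (1,1), (1,0), (0,1) on b, c,
    d, in accordance with bcd = 1. *)
Fixpoint q2 (w : word) : bool :=
  match w with [] => false | x :: w' => xorb (match x with Lb | Ld => true | _ => false end) (q2 w') end.

Lemma q1_app (u v : word) : q1 (u ++ v) = xorb (q1 u) (q1 v).
Proof. induction u; simpl; [now destruct (q1 v)|]. now rewrite IHu, xorb_assoc. Qed.
Lemma q2_app (u v : word) : q2 (u ++ v) = xorb (q2 u) (q2 v).
Proof. induction u; simpl; [now destruct (q2 v)|]. now rewrite IHu, xorb_assoc. Qed.
Lemma q1_rev (w : word) : q1 (rev w) = q1 w.
Proof. induction w as [|x w IH]; simpl; auto. rewrite q1_app, IH; simpl. now destruct x, (q1 w). Qed.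
Lemma q2_rev (w : word) : q2 (rev w) = q2 w.
Proof. induction w as [|x w IH]; simpl; auto. rewrite q2_app, IH; simpl. now destruct x, (q2 w). Qed.

Ltac bool_tac :=
  repeat match goal with
  | |- context [rt ?w] => is_var w; destruct (rt w)
  | |- context [rt (sec ?w ?e)] => destruct (rt (sec w e))
  | |- context [q1 (sec ?w ?e)] => destruct (q1 (sec w e))
  | |- context [q2 (sec ?w ?e)] => destruct (q2 (sec w e))
  | |- context [q1 ?w] => is_var w; destruct (q1 w)
  | |- context [q2 ?w] => is_var w; destruct (q2 w)
  end.

(** Each b, c, d puts [low] into one section and [next] into the other, so the parities of the two
    sections add up to those of this pair. The last equation holds for [low x] and for [next x]
    separately. *)
Lemma sec_types (w : word) (e : bool) :
  rt (sec w (negb e)) = xorb (rt (sec w e)) (q1 w) /\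
  q1 (sec w (negb e)) = xorb (q1 (sec w e)) (q2 w) /\
  q2 (sec w (negb e)) = xorb (q2 (sec w e)) (xorb (q1 w) (q2 w)) /\
  q2 (sec w e) = xorb (xorb (rt (sec w e)) (q1 (sec w e))) (q1 w).
Proof.
  induction w as [|x w IH]; [now destruct e|].
  destruct IH as (I1 & I2 & I3 & I4). simpl.
  rewrite !rt_app, !q1_app, !q2_app, I1, I2, I3, I4.
  destruct e; simpl; destruct x; destruct (rt w); simpl; clear I1 I2 I3 I4;
    repeat split; bool_tac; reflexivity.
Qed.

(* The three parities are the abelianization, so they only depend on the group element. *)
Lemma types_trivial (w : word) : w == [] -> rt w = false /\ q1 w = false /\ q2 w = false.
Proof.
  intros H.
  (* [q1 u] is the sum of the root actions of the two sections; [q2] is in turn the sum of their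
     [q1]. *)
  assert (Q : forall u, u == [] -> q1 u = false).
  { intros u K. destruct (sec_types u false) as (I1 & _).
    rewrite !(weq_rt _ _ (weq_secs _ _ _ K)) in I1. simpl in I1.
    now destruct (q1 u). }
  repeat split; [now apply weq_rt in H | now apply Q |].
  destruct (sec_types w false) as (_ & I2 & _).
  rewrite !Q in I2 by (apply (weq_secs _ [] _ H)). now destruct (q2 w).
Qed.

Lemma weq_types (u v : word) : u == v -> rt u = rt v /\ q1 u = q1 v /\ q2 u = q2 v.
Proof.
  intros H. destruct (types_trivial (u ++ rev v)) as (H0 & H1 & H2).
  { now rewrite H, mul_rev. }
  rewrite rt_app, rt_rev in H0. rewrite q1_app, q1_rev in H1. rewrite q2_app, q2_rev in H2.
  repeat split; apply xorb_eq; assumption.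
Qed.

(* Image in the dihedral group of order 8 (killing b, so that c = d): a word maps to
   [a^(rt w) d^(dpar w) ((ad)^2)^(zpar w)]. *)
Definition dpar (w : word) : bool := xorb (q1 w) (q2 w).
Fixpoint zpar (w : word) : bool :=
  match w with
  | [] => false
  | x :: w' => xorb (match x with Lc | Ld => rt w' | _ => false end) (zpar w')
  end.

Lemma zpar_sec (w : word) : zpar w = q2 (sec w false).
Proof.
  induction w as [|x w IH]; simpl; auto. rewrite q2_app, IH.
  destruct x, (rt w); simpl; now rewrite ?xorb_false_l.
Qed.

Lemma weq_zpar (u v : word) : u == v -> zpar u = zpar v.
Proof. intros H. rewrite !zpar_sec. now apply weq_types, weq_secs. Qed.

(** In the dihedral group, exchanging a and d costs one factor of the central element (ad)^2. *)
Lemma zpar_app (u v : word) :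
  zpar (u ++ v) = xorb (xorb (zpar u) (zpar v)) (dpar u && rt v).
Proof.
  induction u as [|x u IH]; simpl; [now destruct (zpar v)|].
  rewrite IH, rt_app. unfold dpar; simpl.
  destruct x; simpl; destruct (rt u), (rt v), (q1 u), (q2 u), (zpar u), (zpar v); reflexivity.
Qed.

(* The two sections of an element of G correspond under the automorphism of the dihedral
   group that exchanges a and d. *)
Lemma zpar_swap (w : word) (e : bool) :
  zpar (sec w (negb e)) = xorb (zpar (sec w e)) (rt (sec w e) && dpar (sec w e)).
Proof.
  induction w as [|x w IH]; [now destruct e|].
  destruct (sec_types w e) as (I1 & I2 & I3 & I4).
  simpl. rewrite !zpar_app, IH. unfold dpar.
  rewrite !rt_app, !q1_app, !q2_app, I1, I4.
  destruct e; simpl; destruct x; destruct (rt w); simpl; clear I1 I2 I3 I4 IH;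
    rewrite ?zpar_app; unfold dpar; simpl;
    bool_tac; repeat match goal with |- context [zpar ?w] => destruct (zpar w) end; reflexivity.
Qed.

(** * Subgroups that surject onto the abelianization *)

Definition cj (g w : word) : word := g ++ w ++ rev g.

#[export] Instance cj_proper : Proper (weq ==> weq ==> weq) cj.
Proof. intros g g' H w w' K. unfold cj. now rewrite H, K. Qed.

Ltac splits := repeat match goal with |- _ /\ _ => split end.

Create HintDb grp.
#[export] Hint Rewrite rev_app_distr rev_involutive app_nil_r : grp.
#[export] Hint Rewrite <- app_assoc : grp.
Ltac grp :=
  unfold cj; autorewrite with grp; simpl;
  repeat (first [rewrite mul_rev_l | rewrite rev_mul_l | rewrite mul_rev | rewrite rev_mul];
          autorewrite with grp; simpl);
  try reflexivity.

Lemma cj_nil (g : word) : cj g [] == [].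
Proof. grp. Qed.
Lemma cj_mul (g u v : word) : cj g (u ++ v) == cj g u ++ cj g v.
Proof. grp. Qed.
Lemma cj_rev (g u : word) : cj g (rev u) = rev (cj g u).
Proof. unfold cj. now autorewrite with grp. Qed.
Lemma cj_cj (g h u : word) : cj g (cj h u) = cj (g ++ h) u.
Proof. unfold cj. now autorewrite with grp. Qed.

Lemma rt_cj (g w : word) : rt (cj g w) = rt w.
Proof. unfold cj. rewrite !rt_app, rt_rev. now destruct (rt g), (rt w). Qed.
Lemma q1_cj (g w : word) : q1 (cj g w) = q1 w.
Proof. unfold cj. rewrite !q1_app, q1_rev. now destruct (q1 g), (q1 w). Qed.
Lemma q2_cj (g w : word) : q2 (cj g w) = q2 w.
Proof. unfold cj. rewrite !q2_app, q2_rev. now destruct (q2 g), (q2 w). Qed.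

Lemma sec_cj (g w : word) (e : bool) :
  rt w = false ->
  sec (cj g w) e = cj (sec g (xorb e (rt g))) (sec w (xorb e (rt g))).
Proof.
  intros H. unfold cj. rewrite !sec_app, sec_rev, rt_app, rt_rev, H.
  now rewrite xorb_false_l.
Qed.

Record subgroup (H : word -> Prop) : Prop := {
  sub1 : H [];
  subM : forall u v, H u -> H v -> H (u ++ v);
  subV : forall u, H u -> H (rev u);
  subE : forall u v, u == v -> H u -> H v }.

Definition normal (H : word -> Prop) : Prop := forall g w, H w -> H (cj g w).
Definition full (H : word -> Prop) : Prop := forall w, H w.
(** Surjectivity onto F_2^3, the largest elementary abelian 2-quotient; this amounts to density in
    the pro-2 topology. *)
Definition dense (H : word -> Prop) : Prop :=
  forall x y z, exists w, H w /\ rt w = x /\ q1 w = y /\ q2 w = z.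
Definition secH (e : bool) (H : word -> Prop) (w : word) : Prop :=
  exists h, H h /\ rt h = false /\ sec h e == w.
Definition conjH (g : word) (H : word -> Prop) (w : word) : Prop := H (cj g w).

Definition pw (c : bool) (w : word) : word := if c then w else [].

Lemma sub_pw (H : word -> Prop) (c : bool) (w : word) : subgroup H -> H w -> H (pw c w).
Proof. intros SH Hw. destruct c; simpl; auto. now apply sub1. Qed.

Lemma sub_cj (H : word -> Prop) (g w : word) : subgroup H -> H g -> H w -> H (cj g w).
Proof. intros SH Hg Hw. repeat apply (subM _ SH); auto. now apply subV. Qed.

Lemma rt_pw (c : bool) (w : word) : rt (pw c w) = c && rt w.
Proof. now destruct c. Qed.
Lemma q1_pw (c : bool) (w : word) : q1 (pw c w) = c && q1 w.
Proof. now destruct c. Qed.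
Lemma q2_pw (c : bool) (w : word) : q2 (pw c w) = c && q2 w.
Proof. now destruct c. Qed.

Lemma secH_subgroup (e : bool) (H : word -> Prop) : subgroup H -> subgroup (secH e H).
Proof.
  intros SH. split.
  - exists []. splits; [now apply sub1 | reflexivity | reflexivity].
  - intros u v (h & Hh & Rh & Eh) (k & Hk & Rk & Ek). exists (h ++ k).
    splits; [now apply subM | now rewrite rt_app, Rh, Rk |].
    now rewrite sec_app, Rk, xorb_false_r, Eh, Ek.
  - intros u (h & Hh & Rh & Eh). exists (rev h).
    splits; [now apply subV | now rewrite rt_rev |].
    now rewrite sec_rev, Rh, xorb_false_r, Eh.
  - intros u v E (h & Hh & Rh & Eh). exists h. splits; auto. now rewrite Eh.
Qed.

Lemma conjH_subgroup (g : word) (H : word -> Prop) : subgroup H -> subgroup (conjH g H).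
Proof.
  intros SH. unfold conjH. split.
  - apply (subE _ SH []); [symmetry; apply cj_nil | now apply sub1].
  - intros u v Hu Hv. apply (subE _ SH (cj g u ++ cj g v)).
    + symmetry; apply cj_mul.
    + now apply subM.
  - intros u Hu. rewrite cj_rev. now apply subV.
  - intros u v E Hu. apply (subE _ SH (cj g u)); auto. now rewrite E.
Qed.

Lemma cj_Vl (g w : word) : cj g (cj (rev g) w) == w.
Proof. grp. Qed.

Lemma conjH_dense (g : word) (H : word -> Prop) :
  subgroup H -> dense H -> dense (conjH g H).
Proof.
  intros SH DH x y z. destruct (DH x y z) as (w & Hw & R & Q1 & Q2).
  exists (cj (rev g) w). rewrite rt_cj, q1_cj, q2_cj. splits; auto.
  unfold conjH. apply (subE _ SH w); auto. symmetry. apply cj_Vl.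
Qed.

Lemma conjH_full (g : word) (H : word -> Prop) : subgroup H -> full (conjH g H) -> full H.
Proof.
  intros SH F w. apply (subE _ SH (cj g (cj (rev g) w))); [apply cj_Vl | apply F].
Qed.

Ltac norm_types :=
  rewrite ?rt_app, ?q1_app, ?q2_app, ?rt_pw, ?q1_pw, ?q2_pw, ?rt_cj, ?q1_cj, ?q2_cj.

(** The three parities of a section add up to 1 in the first two columns and to 0 in the last two,
    so c1 + c2 = p + q + r, while c3 + c4 = m. Then the first equation yields c2 and the third
    c4. *)
Lemma pick_bits (yr yq zr zq p q r m : bool) :
  let yd := xorb (xorb yr yq) true in let zd := xorb zr zq in
  exists c1 c2 c3 c4,
    xorb (c1 && yr) (xorb (c2 && negb yr) (xorb (c3 && zr) (c4 && zr))) = p /\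
    xorb (c1 && yq) (xorb (c2 && negb yq) (xorb (c3 && zq) (c4 && negb zq))) = q /\
    xorb (c1 && yd) (xorb (c2 && yd) (xorb (c3 && zd) (c4 && negb zd))) = r /\
    xorb c3 c4 = m.
Proof.
  intros yd zd.
  set (s := xorb (xorb p q) r).
  set (c2 := xorb (xorb p (s && yr)) (m && zr)).
  set (c4 := xorb (xorb r (s && yd)) (m && zd)).
  exists (xorb s c2), c2, (xorb m c4), c4. subst yd zd s c2 c4.
  destruct yr, yq, zr, zq, p, q, r, m; now splits.
Qed.

(* Products of y, z of the types of b, d and of their conjugates y', z' by an odd element,
   which have the sections of y and z exchanged. *)
Lemma dense_sections (H : word -> Prop) (e p q r m : bool) :
  subgroup H -> dense H ->
  exists h, H h /\ rt h = false /\ rt (sec h e) = p /\ q1 (sec h e) = q /\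
    q2 (sec h e) = r /\ dpar h = m.
Proof.
  intros SH DH.
  destruct (DH false true true) as (y & Hy & Y0 & Y1 & Y2).
  destruct (DH false false true) as (z & Hz & Z0 & Z1 & Z2).
  destruct (DH true false false) as (x & Hx & X0 & _ & _).
  set (h c1 c2 c3 c4 := pw c1 y ++ pw c2 (cj x y) ++ pw c3 z ++ pw c4 (cj x z)).
  assert (Hh : forall c1 c2 c3 c4, H (h c1 c2 c3 c4)).
  { intros. subst h. cbv beta.
    repeat apply (subM _ SH); apply (sub_pw _ _ _ SH); try apply sub_cj; assumption. }
  assert (L : forall c w f, rt w = false -> sec (pw c w) f = pw c (sec w f)) by (now intros []).
  destruct (sec_types y e) as (TY0 & TY1 & TY2 & TY3).
  destruct (sec_types z e) as (TZ0 & TZ1 & TZ2 & TZ3).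
  enough (exists c1 c2 c3 c4, rt (sec (h c1 c2 c3 c4) e) = p /\ q1 (sec (h c1 c2 c3 c4) e) = q /\
    q2 (sec (h c1 c2 c3 c4) e) = r /\ dpar (h c1 c2 c3 c4) = m) as (c1 & c2 & c3 & c4 & E).
  { exists (h c1 c2 c3 c4). split; [apply Hh|]. split; [|exact E]. subst h. cbv beta.
    norm_types. rewrite Y0, Z0. now destruct c1, c2, c3, c4. }
  assert (E : forall c1 c2 c3 c4, sec (h c1 c2 c3 c4) e =
    pw c1 (sec y e) ++ pw c2 (cj (sec x (negb e)) (sec y (negb e))) ++
    pw c3 (sec z e) ++ pw c4 (cj (sec x (negb e)) (sec z (negb e)))).
  { intros. subst h. cbv beta. rewrite !sec_app. norm_types.
    rewrite Y0, Z0, !andb_false_r, !xorb_false_r, !L, !sec_cj, X0, xorb_true_r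
      by (rewrite ?rt_cj; auto). reflexivity. }
  destruct (pick_bits (rt (sec y e)) (q1 (sec y e)) (rt (sec z e)) (q1 (sec z e)) p q r m)
    as (c1 & c2 & c3 & c4 & F0 & F1 & F2 & F3).
  exists c1, c2, c3, c4. rewrite E. subst h. unfold dpar. norm_types.
    rewrite TY0, TY1, TY2, TY3, TZ0, TZ1, TZ2, TZ3, Y1, Y2, Z1, Z2.
    rewrite <- F0, <- F1, <- F2, <- F3.
    destruct (rt (sec y e)), (q1 (sec y e)), (rt (sec z e)), (q1 (sec z e)), c1, c2, c3, c4;
      splits; reflexivity.
Qed.

Lemma secH_dense (e : bool) (H : word -> Prop) :
  subgroup H -> dense H -> dense (secH e H).
Proof.
  intros SH DH p q r.
  destruct (dense_sections H e p q r false SH DH) as (h & Hh & R & E0 & E1 & E2 & _).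
  exists (sec h e). split; auto. exists h. splits; auto. reflexivity.
Qed.

Definition adz : word := [La; Ld; La; Ld].
Definition ad_nf (i j k : bool) : word := pw i [La] ++ pw j [Ld] ++ pw k adz.
Definition b_ad_nf (q i j k : bool) : word := pw q [Lb] ++ ad_nf i j k.

(** As (ad)^4 = 1, the letters a and d generate a dihedral group of order 8. *)
Lemma ad_nf_spec (w : word) :
  Forall (fun x => x = La \/ x = Ld) w -> w == ad_nf (rt w) (dpar w) (zpar w).
Proof.
  induction 1 as [|x w [-> | ->] _ IH]; [reflexivity| |]; unfold dpar in *; simpl;
    rewrite IH at 1; destruct (rt w), (q1 w), (q2 w), (zpar w); word_eq.
Qed.

Definition abab : word := [La; Lb; La; Lb].

(** Modulo (ab)^2 the letter b is central and c = bd, so every element is a power of b times an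
    element of <a, d>. *)
Lemma b_ad_nf_spec (N : word -> Prop) (w : word) :
  subgroup N -> normal N -> N abab ->
  N (w ++ rev (b_ad_nf (q1 w) (rt w) (dpar w) (zpar w))).
Proof.
  intros SN NN Nb. induction w as [|x w IH]; [exact (sub1 _ SN)|].
  apply (subE _ SN (cj [x] (w ++ rev (b_ad_nf (q1 w) (rt w) (dpar w) (zpar w)))
     ++ [x] ++ b_ad_nf (q1 w) (rt w) (dpar w) (zpar w) ++
     rev (b_ad_nf (q1 (x :: w)) (rt (x :: w)) (dpar (x :: w)) (zpar (x :: w))))).
  - unfold cj. autorewrite with grp. simpl. now rewrite gen_sq_l, rev_mul_l.
  - apply subM; auto.
    enough (forall q i j k q' i' j' k',
      q' = xorb (match x with Lb | Lc => true | _ => false end) q ->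
      i' = xorb (isA x) i ->
      j' = xorb (match x with Lc | Ld => true | _ => false end) j ->
      k' = xorb (match x with Lc | Ld => i | _ => false end) k ->
      N ([x] ++ b_ad_nf q i j k ++ rev (b_ad_nf q' i' j' k'))) as E.
    { apply E; unfold dpar; simpl; destruct x; try reflexivity; now destruct (q1 w), (q2 w). }
    intros q i j k q' i' j' k' -> -> -> ->.
    destruct x, q, i, j, k;
      (apply (subE _ SN []); [word_eq | now apply sub1])
      || (apply (subE _ SN abab); [word_eq | assumption]).
Qed.

(** The normal closure of (ab)^2, the standard branching subgroup, of index 16. *)
Inductive K : word -> Prop :=
| K_1 : K []
| K_gen g : K (cj g abab)
| K_M u v : K u -> K v -> K (u ++ v)
| K_V u : K u -> K (rev u)
| K_E u v : u == v -> K u -> K v.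

Lemma K_subgroup : subgroup K.
Proof. split; [exact K_1 | exact K_M | exact K_V | exact K_E]. Qed.

Lemma K_normal : normal K.
Proof.
  intros h w H. induction H.
  - apply (K_E []); [symmetry; apply cj_nil | apply K_1].
  - rewrite cj_cj. apply K_gen.
  - apply (K_E (cj h u ++ cj h v)); [symmetry; apply cj_mul | now apply K_M].
  - rewrite cj_rev. now apply K_V.
  - apply (K_E (cj h u)); auto. now rewrite H.
Qed.

Lemma K_least (N : word -> Prop) :
  subgroup N -> (forall g, N (cj g abab)) -> forall w, K w -> N w.
Proof.
  intros SN HN w H. induction H; auto.
  - now apply sub1.
  - now apply subM.
  - now apply subV.
  - now apply (subE _ SN u).
Qed.

Lemma full_of_gens (H : word -> Prop) : subgroup H -> (forall x, H [x]) -> full H.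
Proof.
  intros SH HG w. induction w as [|x w IH]; [now apply sub1|].
  change (H ([x] ++ w)). now apply subM.
Qed.

(** F_2^3 is the Frattini quotient of G/K: the classes determine an element of G/K up to (ad)^2. *)
Lemma dense_full_of_K (X : word -> Prop) :
  subgroup X -> dense X -> (forall k, K k -> X k) -> full X.
Proof.
  intros SX DX HK.
  assert (NF : forall w, X w -> X (b_ad_nf (q1 w) (rt w) (dpar w) (zpar w))).
  { intros w Hw.
    apply (subE _ SX (rev (w ++ rev (b_ad_nf (q1 w) (rt w) (dpar w) (zpar w))) ++ w)).
    - grp.
    - apply subM; auto. apply subV; auto. apply HK.
      apply b_ad_nf_spec; auto using K_subgroup, K_normal. apply (K_E (cj [] abab)); [|apply K_gen].
      reflexivity. }
  destruct (DX true false false) as (a & Ha & A0 & A1 & A2).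
  destruct (DX false false true) as (d & Hd & D0 & D1 & D2).
  destruct (DX false true true) as (b & Hb & B0 & B1 & B2).
  apply NF in Ha, Hb, Hd. unfold dpar in *.
  rewrite A0, A1, A2 in Ha. rewrite B0, B1, B2 in Hb. rewrite D0, D1, D2 in Hd. simpl in *.
  (* The unknown powers of (ad)^2 are central, so they cancel in the commutator of the lifts of a
     and d. *)
  assert (Hz : X adz).
  { generalize (subM _ SX _ _ (sub_cj _ _ _ SX Ha Hd) (subV _ SX _ Hd)).
    apply (subE _ SX). destruct (zpar a), (zpar d); word_eq. }
  assert (Kz : forall u k, X (u ++ pw k adz) -> X u).
  { intros u k Hu. apply (subE _ SX ((u ++ pw k adz) ++ rev (pw k adz))); [grp|].
    apply subM; auto. apply subV; auto. now apply sub_pw. }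
  apply (Kz [La]) in Ha. apply (Kz [Ld]) in Hd. apply (Kz [Lb]) in Hb.
  apply full_of_gens; auto. intros []; auto.
  apply (subE _ SX ([Lb] ++ [Ld])); [word_eq | now apply subM].
Qed.

(** * Branching *)

(** Membership of [w] in the rigid stabilizer of the vertex [v], with section [g] there. *)
Fixpoint loc (v : vtx) (g w : word) : Prop :=
  match v with
  | [] => w == g
  | e :: v' => rt w = false /\ sec w (negb e) == [] /\ loc v' g (sec w e)
  end.

Lemma loc_ext (v : vtx) (g g' w w' : word) : g == g' -> w == w' -> loc v g w -> loc v g' w'.
Proof.
  revert w w'; induction v as [|e v IH]; simpl; intros w w' Hg Hw.
  - intros L. now rewrite <- Hw, L.
  - intros (R & T & L). splits.
    + now rewrite <- (weq_rt _ _ Hw).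
    + now rewrite <- (weq_secs _ _ _ Hw).
    + apply (IH (sec w e)); auto. now apply weq_secs.
Qed.

Lemma loc_unique (v : vtx) (g w w' : word) : loc v g w -> loc v g w' -> w == w'.
Proof.
  revert w w'; induction v as [|e v IH]; simpl; intros w w'.
  - intros -> ->. reflexivity.
  - intros (R & T & L) (R' & T' & L'). apply weq_sec. split; [congruence|].
    intros f. destruct (bool_dec f e) as [->|F]; [now apply IH|].
    replace f with (negb e) by (destruct f, e; simpl; congruence). now rewrite T, T'.
Qed.

Lemma loc_mul (v : vtx) (g g' w w' : word) :
  loc v g w -> loc v g' w' -> loc v (g ++ g') (w ++ w').
Proof.
  revert w w'; induction v as [|e v IH]; simpl; intros w w'.
  - intros -> ->. reflexivity.
  - intros (R & T & L) (R' & T' & L').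
    rewrite rt_app, !sec_app, R, R', !xorb_false_r. splits; auto.
    now rewrite T, T'.
Qed.

Lemma loc_rev (v : vtx) (g w : word) : loc v g w -> loc v (rev g) (rev w).
Proof.
  revert w; induction v as [|e v IH]; simpl; intros w.
  - intros ->. reflexivity.
  - intros (R & T & L).
    rewrite rt_rev, !sec_rev, R, !xorb_false_r. splits; auto. now rewrite T.
Qed.

Lemma loc_one (v : vtx) : loc v [] [].
Proof. induction v; simpl; splits; auto; reflexivity. Qed.

Lemma loc_app (v v' : vtx) (g g' w : word) : loc v g w -> loc v' g' g -> loc (v ++ v') g' w.
Proof.
  revert w; induction v as [|e v IH]; simpl; intros w L L'.
  - apply (loc_ext _ g' _ g); auto; [reflexivity | now symmetry].
  - destruct L as (R & T & L). splits; auto.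
Qed.

(* Lysenok's substitution a -> aca, b -> d, c -> b, d -> c splits the section at bit 1. *)
Fixpoint lift1 (w : word) : word :=
  match w with
  | [] => []
  | x :: w' =>
      match x with La => [La; Lc; La] | Lb => [Ld] | Lc => [Lb] | Ld => [Lc] end ++ lift1 w'
  end.

Lemma rt_lift1 (w : word) : rt (lift1 w) = false.
Proof. induction w as [|x w IH]; auto. simpl. rewrite rt_app, IH. now destruct x. Qed.

Lemma sec_lift1 (w : word) : sec (lift1 w) true = w.
Proof.
  induction w as [|x w IH]; auto. simpl. rewrite sec_app, rt_lift1, IH.
  now destruct x.
Qed.

Lemma sec_surj (e r : bool) (g : word) : exists p, rt p = r /\ sec p e = g.
Proof.
  exists (pw (xorb r (negb e)) [La] ++ lift1 g ++ pw (negb e) [La]).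
  rewrite !rt_app, !sec_app, !rt_pw, rt_lift1. simpl.
  split; [now destruct r, e|].
  destruct r, e; simpl; rewrite ?app_nil_r; apply sec_lift1.
Qed.

Fixpoint secv (p : word) (v : vtx) : word :=
  match v with [] => p | e :: v' => secv (sec p e) v' end.

Lemma loc_cj (v : vtx) (g p w : word) :
  loc v g w -> loc (eval p v) (cj (secv p v) g) (cj p w).
Proof.
  revert p w; induction v as [|e v IH]; intros p w.
  - rewrite eval_nil. simpl. now intros ->.
  - rewrite eval_cons. simpl. intros (R & T & L). rewrite rt_cj, !sec_cj by auto.
    replace (xorb (xorb e (rt p)) (rt p)) with e by now destruct e, (rt p).
    replace (xorb (negb (xorb e (rt p))) (rt p)) with (negb e) by now destruct e, (rt p).
    splits; auto. rewrite T. apply cj_nil.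
Qed.

(** Transitivity on levels and self-replication at once, because root action and one section can be
    prescribed independently. *)
Lemma secv_surj (v v' : vtx) (h : word) :
  length v = length v' -> exists p, eval p v = v' /\ secv p v = h.
Proof.
  revert v'; induction v as [|e v IH]; intros [|e' v'] Hl; try discriminate.
  - exists h. split; auto. apply eval_nil.
  - injection Hl as Hl. destruct (IH v' Hl) as (p0 & Ep & Sp).
    destruct (sec_surj e (xorb e e') p0) as (p & Rp & Sp').
    exists p. rewrite eval_cons. simpl. rewrite Rp, Sp', Ep, Sp.
    split; auto. f_equal. now destruct e, e'.
Qed.

Lemma loc_conj (v v' : vtx) (h : word) :
  length v = length v' ->
  exists p, forall g w, loc v g w -> loc v' (cj h g) (cj p w).
Proof.
  intros Hl. destruct (secv_surj v v' h Hl) as (p & <- & <-). exists p.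
  intros g w. apply loc_cj.
Qed.

(* [Ld] conjugates [abab = (ca, ac)] to an element with the same section at bit 0. *)
Definition abab1 : word := [Ld] ++ abab ++ [Ld] ++ rev abab.

Lemma K_abab1 : K abab1.
Proof.
  apply (K_E (cj [Ld] abab ++ rev (cj [] abab))); [word_eq|].
  apply K_M; [apply K_gen | apply K_V, K_gen].
Qed.

(** K contains K x K: [abab1] is [rev abab] placed at bit 1, conjugation moves it to bit e, and the
    extra [[La]] turns [rev abab] into [abab]. *)
Lemma K_loc1 (e : bool) (k : word) : K k -> exists w, K w /\ loc [e] k w.
Proof.
  revert k. apply (K_least (fun k => exists w, K w /\ loc [e] k w)).
  - split.
    + exists []. split; [apply K_1 | apply loc_one].
    + intros u v (w & Kw & Lw) (w' & Kw' & Lw'). exists (w ++ w').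
      split; [now apply K_M | now apply loc_mul].
    + intros u (w & Kw & Lw). exists (rev w). split; [now apply K_V | now apply loc_rev].
    + intros u v E (w & Kw & Lw). exists w. split; auto.
      apply (loc_ext _ u _ w); auto. reflexivity.
  - intros g. destruct (loc_conj [true] [e] (g ++ [La]) eq_refl) as (p & Hp).
    exists (cj p abab1). split; [apply K_normal, K_abab1|].
    apply (loc_ext _ (cj (g ++ [La]) (rev abab)) _ (cj p abab1)); [|reflexivity|].
    + rewrite <- cj_cj. apply cj_proper; [reflexivity | word_eq].
    + apply Hp. simpl. splits; [reflexivity | word_eq | word_eq].
Qed.

Lemma K_loc (v : vtx) (k : word) : K k -> exists w, K w /\ loc v k w.
Proof.
  revert k; induction v as [|e v IH]; intros k Hk.
  - exists k. split; auto. simpl. reflexivity.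
  - destruct (IH k Hk) as (w & Kw & Lw). destruct (K_loc1 e w Kw) as (u & Ku & Lu).
    exists u. split; auto. now apply (loc_app [e] v w).
Qed.

Definition contains_K (m : nat) (X : word -> Prop) : Prop :=
  forall v k w, length v = m -> K k -> loc v k w -> X w.

Definition rist (X : word -> Prop) (w : word) : Prop :=
  exists h, X h /\ rt h = false /\ sec h false == [] /\ sec h true == w.

Lemma rist_subgroup (X : word -> Prop) : subgroup X -> subgroup (rist X).
Proof.
  intros SX. split.
  - exists []. splits; [now apply sub1 | reflexivity | reflexivity | reflexivity].
  - intros u v (h & Hh & Rh & Fh & Eh) (k & Hk & Rk & Fk & Ek). exists (h ++ k).
    rewrite rt_app, !sec_app, Rh, Rk, !xorb_false_r, Eh, Ek.
    splits; [now apply subM | reflexivity | now rewrite Fh, Fk | reflexivity].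
  - intros u (h & Hh & Rh & Fh & Eh). exists (rev h).
    rewrite rt_rev, !sec_rev, Rh, !xorb_false_r, Eh.
    splits; [now apply subV | reflexivity | now rewrite Fh | reflexivity].
  - intros u v E (h & Hh & Rh & Fh & Eh). exists h. splits; auto. now rewrite Eh.
Qed.

(** Conjugating by an element of [X] with section g at bit 1 is harmless at bit 0, where the
    conjugated element is trivial. *)
Lemma rist_normal (X : word -> Prop) :
  subgroup X -> full (secH true X) -> normal (rist X).
Proof.
  intros SX FX g w (h & Hh & Rh & Fh & Eh). destruct (FX g) as (k & Hk & Rk & Ek).
  exists (cj k h). rewrite rt_cj, !sec_cj, Rk, !xorb_false_r by auto.
  splits; auto.
  - now apply sub_cj.
  - now rewrite Fh, cj_nil.
  - now rewrite Ek, Eh.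
Qed.

Lemma rist_dihedral (X : word -> Prop) (w : word) :
  rist X w -> rt w = false /\ dpar w = false /\ zpar w = false.
Proof.
  intros (h & _ & Rh & Fh & Eh).
  destruct (weq_types _ _ Fh) as (F0 & F1 & F2). simpl in *.
  pose proof (weq_zpar _ _ Fh) as F3. simpl in F3.
  destruct (weq_types _ _ Eh) as (E0 & E1 & E2). unfold dpar. rewrite <- E0, <- E1, <- E2.
  rewrite <- (weq_zpar _ _ Eh).
  destruct (sec_types h false) as (I1 & I2 & I3 & I4). simpl in *.
  pose proof (zpar_swap h false) as I5. simpl in I5. unfold dpar in I5.
  rewrite I1, I2, I3, I5. rewrite F0, F1, F2 in *. rewrite F3.
  destruct (q1 h); try discriminate. now destruct (q2 h).
Qed.

Lemma full_secH_swap (X : word -> Prop) (e : bool) :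
  subgroup X -> dense X -> full (secH e X) -> forall f, full (secH f X).
Proof.
  intros SX DX FX f w. destruct (bool_dec f e) as [->|F]; [apply FX|].
  replace f with (negb e) by (destruct f, e; simpl; congruence).
  destruct (DX true false false) as (x & Hx & Rx & _).
  destruct (FX (cj (rev (sec x e)) w)) as (k & Hk & Rk & Ek).
  exists (cj x k). rewrite rt_cj, sec_cj, Rx, xorb_true_r, negb_involutive, Ek by auto.
  splits; auto; [now apply sub_cj | apply cj_Vl].
Qed.

Definition rist_ad (X : word -> Prop) (w : word) : Prop :=
  exists n e, rist X n /\ Forall (fun x => x = La \/ x = Ld) e /\ w == n ++ e.

Lemma rist_ad_subgroup (X : word -> Prop) :
  subgroup X -> full (secH true X) -> subgroup (rist_ad X).
Proof.
  intros SX FX. pose proof (rist_subgroup X SX) as SR. pose proof (rist_normal X SX FX) as NR.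
  split.
  - exists [], []. splits; [now apply sub1 | constructor | reflexivity].
  - intros u v (n & e & Hn & He & E) (n' & e' & Hn' & He' & E').
    exists (n ++ cj e n'), (e ++ e'). splits.
    + apply subM; auto.
    + now apply Forall_app.
    + rewrite E, E'. grp.
  - intros u (n & e & Hn & He & E).
    exists (cj (rev e) (rev n)), (rev e). splits.
    + apply NR. now apply subV.
    + now apply Forall_rev.
    + rewrite E. grp.
  - intros u v E (n & e & Hn & He & E'). exists n, e. splits; auto. now rewrite <- E.
Qed.

(* Elements of [rist X] die in the dihedral quotient, so [b = n e] with e in <a, d> forces
   [e = 1]; the quotient of the first level stabilizer by [<b>^G x <b>^G] is a graph. *)
Lemma full_of_rist_ad (X : word -> Prop) :
  subgroup X -> dense X -> (forall e, full (secH e X)) -> full (rist_ad X) -> full X.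
Proof.
  intros SX DX FX FY.
  pose proof (rist_subgroup X SX) as SR.
  pose proof (rist_normal X SX (FX true)) as NR.
  assert (Rb : rist X [Lb]).
  { destruct (FY [Lb]) as (n & e & Hn & He & E).
    destruct (rist_dihedral _ _ Hn) as (R & D & Z).
    destruct (weq_types _ _ E) as (E0 & E1 & E2). pose proof (weq_zpar _ _ E) as E3.
    rewrite rt_app, R in E0. rewrite q1_app in E1. rewrite q2_app in E2.
    rewrite zpar_app, D, Z in E3. unfold dpar in D. simpl in *.
    apply (subE _ SR n); auto. rewrite E.
    rewrite (ad_nf_spec e He). unfold dpar.
    rewrite <- E0. destruct (zpar e); try discriminate.
    replace (xorb (q1 e) (q2 e)) with false;
      [|destruct (q1 n), (q2 n), (q1 e), (q2 e); simpl in *; congruence].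
    simpl. now rewrite app_nil_r. }
  (* Divide w by some k in [X] with the same section at 0. The quotient v has trivial section at 0,
     so its section at 1 dies in the dihedral group; it is a power of b modulo [rist X], which
     contains b. *)
  assert (EV : forall w, rt w = false -> X w).
  { intros w Rw. destruct (FX false (sec w false)) as (k & Hk & Rk & Ek).
    set (v := rev k ++ w).
    assert (Rv : rt v = false) by (subst v; now rewrite rt_app, rt_rev, Rk, Rw).
    assert (Fv : sec v false == []).
    { subst v. rewrite sec_app, sec_rev, Rk, Rw, xorb_false_r, Ek. apply rev_mul. }
    assert (Rs : rist X (sec v true)).
    { destruct (rist_dihedral (fun _ => True) (sec v true)) as (R & D & Z).
      { exists v. splits; auto. reflexivity. }
      assert (Nb : rist X abab).
      { apply (subE _ SR (cj [La] [Lb] ++ [Lb])); [word_eq|]. apply subM; auto. }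
      pose proof (b_ad_nf_spec _ (sec v true) SR NR Nb) as B. rewrite R, D, Z in B.
      apply (subE _ SR (_ ++ pw (q1 (sec v true)) [Lb])) with (2 := subM _ SR _ _ B (sub_pw _ _ _ SR Rb)).
      destruct (q1 (sec v true)); simpl; rewrite ?app_nil_r; [|reflexivity].
      rewrite <- app_assoc. simpl. now rewrite gen_sq, app_nil_r. }
    destruct Rs as (h & Hh & Rh & Fh & Eh).
    apply (subE _ SX (k ++ v)); [subst v; grp|]. apply subM; auto.
    apply (subE _ SX h); auto. apply weq_by_sec; [congruence | | auto]. now rewrite Fh, Fv. }
  intros w. destruct (DX true false false) as (x & Hx & Rx & _).
  destruct (rt w) eqn:Rw; [|now apply EV].
  apply (subE _ SX (x ++ rev x ++ w)); [apply mul_rev_l|]. apply subM; auto.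
  apply EV. now rewrite rt_app, rt_rev, Rx, Rw.
Qed.

Lemma secH_contains_K (m : nat) (e : bool) (X : word -> Prop) :
  contains_K (S m) X -> contains_K m (secH e X).
Proof.
  intros CX v k w Hv Hk L. destruct (K_loc (e :: v) k Hk) as (h & Kh & Lh).
  exists h. splits.
  - apply (CX (e :: v) k); auto. simpl. congruence.
  - apply Lh.
  - apply (loc_unique v k); auto. apply Lh.
Qed.

Lemma rist_contains_K (m : nat) (X : word -> Prop) :
  contains_K (S m) X -> contains_K m (rist X).
Proof.
  intros CX v k w Hv Hk L. destruct (K_loc (true :: v) k Hk) as (h & Kh & Lh).
  exists h. splits.
  - apply (CX (true :: v) k); auto. simpl. congruence.
  - apply Lh.
  - apply Lh.
  - apply (loc_unique v k); auto. apply Lh.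
Qed.

(* Sections at bit 0 trivial in the abelianization can be lifted by an element whose section
   at bit 1 is also trivial there, by lifting letter by letter. *)
Lemma rist_type_b (X : word -> Prop) :
  subgroup X -> dense X -> full (secH false X) ->
  exists t, rist X t /\ rt t = false /\ q1 t = true /\ q2 t = true.
Proof.
  intros SX DX FX.
  destruct (FX [La]) as (ka & Ha & Ra & Ea). destruct (FX [Lc]) as (kc & Hc & Rc & Ec).
  destruct (FX [Ld]) as (kd & Hd & Rd & Ed).
  (* The letter b is lifted as cd, so that the type of the section at 1 depends on the word only
     through its three parities. *)
  set (L x := match x with La => ka | Lb => kc ++ kd | Lc => kc | Ld => kd end).
  assert (HL : forall w, X (flat_map L w) /\ rt (flat_map L w) = false /\
                 sec (flat_map L w) false == w).
  { induction w as [|x w (Hw & Rw & Ew)]; [splits; [exact (sub1 _ SX)|reflexivity|reflexivity]|].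
    cbn [flat_map]. rewrite rt_app, sec_app, Rw, xorb_false_r, Ew.
    splits.
    - apply subM; auto. destruct x; simpl; auto. now apply subM.
    - destruct x; simpl; rewrite ?rt_app, ?Ra, ?Rc, ?Rd; auto.
    - change (x :: w) with ([x] ++ w). apply app_proper; [|reflexivity].
      destruct x; simpl; auto. rewrite sec_app, Rd, xorb_false_r, Ec, Ed. word_eq. }
  assert (Lin : forall f : word -> bool, f [] = false ->
    (forall u v, f (u ++ v) = xorb (f u) (f v)) -> forall w,
    f (sec (flat_map L w) true) =
      xorb (rt w && f (sec ka true)) (xorb (q1 w && f (sec kc true)) (q2 w && f (sec kd true)))).
  { intros f f0 fM w. induction w as [|x w IH]; [exact f0|].
    destruct (HL w) as (_ & Rw & _).
    cbn [flat_map]. rewrite sec_app, fM, Rw, xorb_false_r, IH. simpl.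
    destruct x; simpl; rewrite ?sec_app, ?fM, ?Rd;
      destruct (rt w), (q1 w), (q2 w); simpl;
      destruct (f (sec ka true)), (f (sec kc true)), (f (sec kd true)); reflexivity. }
  (* Trivial type at bit 0 forces [q1 h = false]; asking for [dpar h = true] then gives
     [q2 h = true], and the section at 1 gets the type of b. *)
  destruct (dense_sections X false false false false true SX DX) as (h & Hh & Rh & T0 & T1 & T2 & D).
  set (w := sec h false) in *. destruct (HL w) as (Hk & Rk & Ek).
  pose proof (Lin rt eq_refl rt_app w) as M0. pose proof (Lin q1 eq_refl q1_app w) as M1.
  pose proof (Lin q2 eq_refl q2_app w) as M2. rewrite T0, T1, T2 in M0, M1, M2. simpl in *.
  set (k := flat_map L w) in *.
  destruct (sec_types h false) as (I1 & I2 & I3 & I4). fold w in I1, I2, I3, I4. simpl in *.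
  rewrite T0, T1, T2 in *. unfold dpar in D.
  exists (rev (sec k true) ++ sec h true).
  rewrite rt_app, q1_app, q2_app, rt_rev, q1_rev, q2_rev, M0, M1, M2, I1, I2, I3.
  split.
  - exists (rev k ++ h). rewrite rt_app, rt_rev, Rk, Rh, !sec_app, !sec_rev, Rh, Rk. simpl.
    splits; [apply subM; auto; now apply subV | reflexivity | | reflexivity].
    rewrite Ek. apply rev_mul.
  - destruct (q1 h), (q2 h); try discriminate; auto.
Qed.

(** The commutator c has the inverse of k1 at bit 0 and a conjugate of k1 at bit 1; commuting it
    with h2, which is trivial at bit 1, removes the second coordinate. *)
Lemma loc_comm (T k1 k2 h1 h2 : word) :
  rt T = true -> loc [false] k1 h1 -> loc [false] k2 h2 ->
  let c := cj T h1 ++ rev h1 in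
  loc [false] (rev k1 ++ k2 ++ k1 ++ rev k2) (c ++ h2 ++ rev c ++ rev h2).
Proof.
  simpl. intros RT (R1 & T1 & L1) (R2 & T2 & L2).
  set (c := cj T h1 ++ rev h1).
  assert (Rc : rt c = false) by (subst c; now rewrite rt_app, rt_cj, rt_rev, R1).
  assert (Fc : sec c false == rev k1).
  { subst c. rewrite sec_app, sec_rev, rt_rev, R1, sec_cj, RT by auto. simpl.
    now rewrite T1, L1, cj_nil. }
  rewrite !rt_app, !rt_rev, Rc, R2. splits; auto;
    rewrite !sec_app, !sec_rev, !rt_app, !rt_rev, Rc, R2; simpl.
  - rewrite T2. simpl. rewrite app_nil_r. apply mul_rev.
  - rewrite Fc, L2. now rewrite rev_involutive.
Qed.

(** Here abab = (ca, ac) and k is abab placed at bit 0, so the commutator lives at bit 0, where it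
    equals c baba c baba = (1, baba). *)
Lemma loc_abab_comm :
  let k := cj [Lb; La] abab1 in
  loc [false; true] (rev abab) (abab ++ k ++ rev abab ++ rev k).
Proof. intros k. simpl. splits; first [reflexivity | word_eq]. Qed.

(** Some child e of the root is fixed by t while its two children are exchanged. The double
    commutator with elements at [e; 0], which may be any elements of G by normality, lands at
    [e; 0], and [loc_abab_comm] goes two levels deeper: this makes level 4. Conjugation spreads the
    result over the level. *)
Lemma rist_branch (X : word -> Prop) (t : word) :
  subgroup X -> full (secH true X) -> rist X t -> rt t = false -> q1 t = true ->
  contains_K 4 (rist X).
Proof.
  intros SX FX Rt Pt Qt.
  pose proof (rist_subgroup X SX) as SR. pose proof (rist_normal X SX FX) as NR.
  assert (He : exists e, rt (sec t e) = true).
  { destruct (sec_types t false) as (I1 & _). rewrite Qt in I1. simpl in I1.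
    destruct (rt (sec t false)) eqn:F; [now exists false | now exists true]. }
  destruct He as (e & He).
  set (k := cj [Lb; La] abab1).
  assert (Kk : K k) by apply K_normal, K_abab1.
  assert (Kab : K abab) by (apply (K_E (cj [] abab)); [reflexivity | apply K_gen]).
  destruct (K_loc [e; false] (rev abab) (K_V _ Kab)) as (h1 & _ & L1).
  destruct (K_loc [e; false] k Kk) as (h2 & _ & L2).
  set (c := cj t h1 ++ rev h1).
  set (W := c ++ h2 ++ rev c ++ rev h2).
  assert (Hc : rist X c).
  { apply (subE _ SR (t ++ cj h1 (rev t))); [subst c; grp|].
    apply subM; auto. apply NR. now apply subV. }
  assert (HW : rist X W).
  { apply (subE _ SR (c ++ cj h2 (rev c))); [subst W; grp|].
    apply subM; auto. apply NR. now apply subV. }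
  assert (LW : loc [e; false; false; true] (rev abab) W).
  { apply (loc_app [e; false] _ (abab ++ k ++ rev abab ++ rev k)); [|apply loc_abab_comm].
    destruct L1 as (R1 & T1 & L1). destruct L2 as (R2 & T2 & L2).
    assert (Rc : rt c = false) by (subst c; now rewrite rt_app, rt_cj, rt_rev, R1).
    pose proof (loc_comm (sec t e) _ _ _ _ He L1 L2) as L. simpl in L.
    change (rt W = false /\ sec W (negb e) == [] /\
      loc [false] (abab ++ k ++ rev abab ++ rev k) (sec W e)).
    assert (Sc : forall f, sec c f = cj (sec t f) (sec h1 f) ++ rev (sec h1 f)).
    { intros f. subst c.
      now rewrite sec_app, sec_rev, rt_rev, R1, xorb_false_r, sec_cj, Pt, xorb_false_r by auto. }
    assert (SW : forall f, sec W f = sec c f ++ sec h2 f ++ rev (sec c f) ++ rev (sec h2 f)).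
    { intros f. subst W. rewrite !sec_app, !sec_rev, !rt_app, !rt_rev, Rc, R2.
      now rewrite !xorb_false_r. }
    splits.
    - subst W. now rewrite !rt_app, !rt_rev, Rc, R2.
    - rewrite SW, T2, Sc, T1, cj_nil. reflexivity.
    - rewrite SW, Sc. exact L. }
  intros v kk w Hv Hk Lw.
  enough (exists u, loc v kk u /\ rist X u) as (u & Lu & Hu).
  { apply (subE _ SR u); auto. now apply (loc_unique v kk). }
  clear w Lw. revert kk Hk. apply (K_least (fun kk => exists u, loc v kk u /\ rist X u)).
  - split.
    + exists []. split; [apply loc_one | now apply sub1].
    + intros u u' (w & Lw & Hw) (w' & Lw' & Hw'). exists (w ++ w').
      split; [now apply loc_mul | now apply subM].
    + intros u (w & Lw & Hw). exists (rev w). split; [now apply loc_rev | now apply subV].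
    + intros u u' E (w & Lw & Hw). exists w. split; auto.
      apply (loc_ext _ u _ w); auto. reflexivity.
  - intros g. destruct (loc_conj [e; false; false; true] v (g ++ [La]) (eq_sym Hv)) as (p & Hp).
    exists (cj p W). split; [|now apply NR].
    apply (loc_ext _ (cj (g ++ [La]) (rev abab)) _ (cj p W)); [|reflexivity|auto].
    rewrite <- cj_cj. apply cj_proper; [reflexivity | word_eq].
Qed.

Lemma rist_ad_dense (X : word -> Prop) (t : word) :
  subgroup X -> full (secH true X) ->
  rist X t -> rt t = false -> q1 t = true -> q2 t = true -> dense (rist_ad X).
Proof.
  intros SX FX Ht T0 T1 T2 x y z.
  exists (pw y t ++ (pw x [La] ++ pw (xorb y z) [Ld])). norm_types. rewrite T0, T1, T2. splits.
  - exists (pw y t), (pw x [La] ++ pw (xorb y z) [Ld]). splits; [| |reflexivity].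
    + apply sub_pw; auto. now apply rist_subgroup.
    + destruct x, (xorb y z); simpl; auto 6.
  - now destruct x, y, z.
  - now destruct x, y, z.
  - now destruct x, y, z.
Qed.

Lemma rist_ad_contains_K (m : nat) (X : word -> Prop) :
  contains_K m (rist X) -> contains_K m (rist_ad X).
Proof.
  intros CX v k w Hv Hk L. exists w, []. splits; [now apply (CX v k) | constructor |].
  now rewrite app_nil_r.
Qed.

(** The induction hypothesis is needed for all subgroups: it serves both the section subgroups and
    [rist_ad X], each of which contains K one level higher up in the tree. *)
Lemma dense_full_of_contains_K (m : nat) (X : word -> Prop) :
  subgroup X -> dense X -> contains_K m X -> full X.
Proof.
  revert X; induction m as [|m IH]; intros X SX DX CX.
  - apply dense_full_of_K; auto. intros k Hk. apply (CX [] k); auto. simpl. reflexivity.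
  - assert (FX : forall e, full (secH e X)).
    { intros e. apply IH; auto using secH_subgroup, secH_dense, secH_contains_K. }
    destruct (rist_type_b X SX DX (FX false)) as (t & Ht & T0 & T1 & T2).
    apply full_of_rist_ad; auto. apply IH.
    + now apply rist_ad_subgroup.
    + now apply (rist_ad_dense X t).
    + now apply rist_ad_contains_K, rist_contains_K.
Qed.

Theorem full_of_secH (X : word -> Prop) (e : bool) :
  subgroup X -> dense X -> full (secH e X) -> full X.
Proof.
  intros SX DX FXe. pose proof (full_secH_swap X e SX DX FXe) as FX.
  destruct (rist_type_b X SX DX (FX false)) as (t & Ht & T0 & T1 & T2).
  apply full_of_rist_ad; auto. apply (dense_full_of_contains_K 4).
  - now apply rist_ad_subgroup.
  - now apply (rist_ad_dense X t).
  - apply rist_ad_contains_K. now apply (rist_branch X t).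
Qed.

(** * Conjugates of b, c, d in a subgroup *)

Definition has_cj (x : gen) (H : word -> Prop) : Prop := exists g, H (cj g [x]).

(** An odd element of [H] corrects the parity of the conjugator, so either section of w can be made
    to appear at bit e. *)
Lemma secH_cj (H : word -> Prop) (g w : word) (e e' : bool) :
  subgroup H -> dense H -> rt w = false -> H (cj g w) ->
  exists g', secH e H (cj g' (sec w e')).
Proof.
  intros SH DH Rw Hw.
  assert (exists g', xorb e (rt g') = e' /\ H (cj g' w)) as (g' & <- & Hg).
  { destruct (bool_dec (xorb e (rt g)) e') as [E|E]; [now exists g|].
    destruct (DH true false false) as (x & Hx & Rx & _).
    exists (x ++ g). rewrite rt_app, Rx, <- cj_cj. split; [|now apply sub_cj].
    destruct e, e', (rt g); simpl in *; congruence. }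
  exists (sec g' (xorb e (rt g'))), (cj g' w). splits; auto.
  - now rewrite rt_cj.
  - rewrite sec_cj by auto. reflexivity.
Qed.

Lemma has_cj_secH (x : gen) (e : bool) (H : word -> Prop) :
  isA x = false -> subgroup H -> dense H -> has_cj x H -> has_cj (next x) (secH e H).
Proof.
  intros Hx SH DH (g & Hg).
  destruct (secH_cj H g [x] e true SH DH) as (g' & Hg'); auto.
  - simpl. now rewrite Hx.
  - exists g'. simpl in Hg'. unfold gsec in Hg'. now rewrite Hx in Hg'.
Qed.

Definition nonA (x : gen) : bool := negb (isA x).
Definition cnt (w : word) : nat := length (filter nonA w).

Lemma cnt_app (u v : word) : cnt (u ++ v) = cnt u + cnt v.
Proof. unfold cnt. now rewrite filter_app, length_app. Qed.

Lemma cnt_sec (w : word) : cnt (sec w false) + cnt (sec w true) = cnt w.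
Proof.
  induction w as [|x w IH]; auto. simpl sec. rewrite !cnt_app.
  change (cnt (x :: w)) with (cnt ([x] ++ w)). rewrite !cnt_app, <- IH.
  destruct x, (rt w); cbn; lia.
Qed.

Fixpoint rep (l : word) : word :=
  match l with [] => [] | x :: l' => x :: La :: rep l' end.

(* Every g is in a^e rep(l) {1,b,c,d}, where 2 |l| + e, a distance in the Bass-Serre tree of
   <a> * {1,b,c,d}, is at most the length of g. *)
Lemma normal_form (w : word) : exists e l t,
  w == pw e [La] ++ rep l ++ t /\ Forall (fun x => isA x = false) l /\
  (t = [] \/ exists x, t = [x] /\ isA x = false) /\
  2 * length l + Nat.b2n e <= length w /\
  (2 * length l + Nat.b2n e = length w -> l = filter nonA w) /\
  length l + length t <= cnt w.
Proof.
  induction w as [|x w (e & l & t & E & Hl & Ht & L1 & L2 & L3)].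
  { exists false, [], []. simpl. splits; auto. reflexivity. }
  assert (C : cnt (x :: w) = (if isA x then 0 else 1) + cnt w) by now destruct x.
  rewrite C. simpl length.
  destruct (isA x) eqn:Ax.
  - replace x with La in * by now destruct x. exists (negb e), l, t.
    splits; auto.
    + rewrite E. destruct e; simpl; [apply gen_sq_l | reflexivity].
    + destruct e; simpl in *; lia.
    + intros F. simpl. apply L2. destruct e; simpl in *; lia.
  - assert (Fx : filter nonA (x :: w) = x :: filter nonA w) by now destruct x.
    rewrite Fx. destruct e.
    + exists false, (x :: l), t. simpl in *. splits; auto; try lia.
      * now rewrite E.
      * intros F. f_equal. apply L2. lia.
    + destruct l as [|v l].
      * assert (M : exists t', x :: t == t' /\ (t' = [] \/ exists y, t' = [y] /\ isA y = false) /\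
                      length t' <= 1 + length t).
        { destruct Ht as [-> | (y & -> & Ay)].
          - exists [x]. splits; [reflexivity | right; now exists x | auto].
          - destruct (gen_eqb x y) eqn:F.
            + apply gen_eqb_eq in F. subst y. exists []. splits; [apply gen_sq | auto | simpl; lia].
            + exists [third x y]. splits; auto.
              * apply klein; auto. intros ->. now destruct y.
              * right. exists (third x y). split; auto. now destruct x, y. }
        destruct M as (t' & M1 & M2 & M3). exists false, [], t'. simpl in *.
        splits; auto; try lia. now rewrite E, M1.
      * inversion Hl as [|? ? Av Hl' E1]; subst.
        destruct (gen_eqb x v) eqn:F.
        -- apply gen_eqb_eq in F. subst v. exists true, l, t. simpl in *.
           splits; auto; try lia. rewrite E. apply gen_sq_l.
        -- exists false, (third x v :: l), t. simpl in *. splits; auto; try lia.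
           ++ rewrite E. change (x :: v :: La :: rep l ++ t) with ([x; v] ++ La :: rep l ++ t).
              rewrite klein; auto; [reflexivity|]. intros ->. now destruct v.
           ++ constructor; auto. now destruct x, v.
Qed.

(* The element of the first level stabilizer in {1, a} rep(l). *)
Fixpoint erep (l : word) : word :=
  match l with
  | [] => []
  | x :: l' => cj (pw (Nat.even (length l')) [La]) [x] ++ erep l'
  end.

Lemma erep_rep (l : word) : erep l == pw (Nat.odd (length l)) [La] ++ rep l.
Proof.
  induction l as [|x l IH]; [reflexivity|].
  simpl erep. rewrite IH. simpl length. rewrite Nat.odd_succ, <- Nat.negb_even.
  destruct (Nat.even (length l)); simpl; [|reflexivity].
  apply cons_proper; auto. apply cons_proper; auto. reflexivity.
Qed.

Lemma rt_erep (l : word) : Forall (fun x => isA x = false) l -> rt (erep l) = false.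
Proof.
  induction 1 as [|x l Hx Hl IH]; auto. simpl erep. rewrite rt_app, rt_cj, IH. simpl.
  now rewrite Hx.
Qed.

Lemma sec_erep_cons (x : gen) (l : word) (e : bool) :
  isA x = false -> Forall (fun x => isA x = false) l ->
  sec (erep (x :: l)) e = gsec x (xorb e (Nat.even (length l))) ++ sec (erep l) e.
Proof.
  intros Hx Hl. simpl erep. rewrite sec_app, rt_erep, sec_cj by (simpl; rewrite ?Hx; auto).
  rewrite xorb_false_r. f_equal.
  destruct (Nat.even (length l)); simpl; unfold cj; simpl; now rewrite !app_nil_r, ?xorb_false_r, ?xorb_true_r.
Qed.

(** The letters of l contribute [next] alternately to the two sections, the last letter to the one
    at bit 0; so the counts are |l|/2 rounded up at 0 and down at 1. *)
Lemma cnt_sec_erep (l : word) (e : bool) :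
  Forall (fun x => isA x = false) l ->
  2 * cnt (sec (erep l) e) + Nat.b2n e <= length l + 1.
Proof.
  intros Hl.
  assert (2 * cnt (sec (erep l) false) = length l + Nat.b2n (Nat.odd (length l)) /\
          2 * cnt (sec (erep l) true) + Nat.b2n (Nat.odd (length l)) = length l) as (L0 & L1).
  { induction Hl as [|x l Hx Hl (IH0 & IH1)]; [now split|].
    rewrite !sec_erep_cons, !cnt_app by auto. simpl length.
    rewrite Nat.odd_succ, <- Nat.negb_even in *.
    destruct x, (Nat.even (length l)); try discriminate; cbn in *; lia. }
  destruct e, (Nat.odd (length l)); simpl in *; lia.
Qed.

(** In the quotient {1, b, c, d} obtained by killing a, the image of [w] is neither 1 nor [x]. *)
Definition off (x : gen) (w : word) : Prop :=
  (q1 w, q2 w) <> (false, false) /\ (q1 w, q2 w) <> (q1 [x], q2 [x]).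

Lemma off_weq (x : gen) (u v : word) : u == v -> off x u -> off x v.
Proof. intros E. unfold off. destruct (weq_types _ _ E) as (_ & -> & ->). auto. Qed.

(* Passing to a section shortens an element of the first level stabilizer; the section at 0
   of the square of any other element is not longer, and multiplies its type by the same
   shift as [next]. The relation R is any property that follows the shift. *)
Lemma find_letter (R : gen -> (word -> Prop) -> Prop) :
  (forall x e H, isA x = false -> subgroup H -> dense H -> R x H -> R (next x) (secH e H)) ->
  (forall x y H, isA x = false -> isA y = false -> x <> y -> subgroup H -> dense H ->
     R x H -> has_cj y H -> full H) ->
  forall n x w H, isA x = false -> subgroup H -> dense H -> R x H ->
    H w -> off x w -> cnt w <= n -> full H.
Proof.
  intros Rs Rf.
  assert (Anext : forall x, isA x = false -> isA (next x) = false) by now intros [].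
  assert (Odd : forall n,
    (forall x w H, isA x = false -> subgroup H -> dense H -> R x H ->
       H w -> off x w -> cnt w <= n -> rt w = false -> full H) ->
    forall x w H, isA x = false -> subgroup H -> dense H -> R x H ->
       H w -> off x w -> cnt w <= n -> full H).
  { intros n Ev.
    assert (St : forall x w H, isA x = false -> subgroup H -> dense H -> R x H ->
       H w -> off x w -> cnt w <= n -> rt w = true ->
       (forall w', rt w' = q1 w -> q1 w' = q2 w -> q2 w' = xorb (q1 w) (q2 w) ->
          secH false H w' -> off (next x) w' -> cnt w' <= n -> full (secH false H)) -> full H).
    { intros x w H Ax SH DH HR Hw Ow Cw Rw C. apply (full_of_secH _ false SH DH).
      destruct (sec_types w false) as (I1 & I2 & I3 & _). simpl in *.
      assert (Q1 : q1 (sec (w ++ w) false) = q2 w).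
      { rewrite sec_app, q1_app, Rw. simpl. rewrite I2. now destruct (q1 (sec w false)), (q2 w). }
      assert (Q2 : q2 (sec (w ++ w) false) = xorb (q1 w) (q2 w)).
      { rewrite sec_app, q2_app, Rw. simpl. rewrite I3.
        now destruct (q2 (sec w false)), (xorb (q1 w) (q2 w)). }
      apply (C (sec (w ++ w) false)); auto.
      - rewrite sec_app, rt_app, Rw. simpl. rewrite I1. now destruct (rt (sec w false)), (q1 w).
      - exists (w ++ w). splits; [now apply subM | rewrite rt_app, Rw; auto | reflexivity].
      - unfold off in *. rewrite Q1, Q2. destruct Ow as [O1 O2].
        destruct x, (q1 w), (q2 w); try discriminate; simpl in *; split; congruence.
      - pose proof (cnt_sec w). rewrite sec_app, cnt_app, Rw. simpl. lia. }
    intros x w H Ax SH DH HR Hw Ow Cw.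
    destruct (rt w) eqn:Rw; [|now apply (Ev x w)].
    (* The root actions met along the squarings are q1, q2, q1 + q2 of the original w. They add up
       to 0, so at most three squarings lead to an even element. *)
    apply (St x w); auto. intros w1 R1 P1 Q1 H1 O1 C1.
    destruct (rt w1) eqn:Rw1;
      [|apply (Ev (next x) w1); auto using secH_subgroup, secH_dense].
    apply (St (next x) w1); auto using secH_subgroup, secH_dense.
    intros w2 R2 P2 Q2 H2 O2 C2.
    destruct (rt w2) eqn:Rw2;
      [|apply (Ev (next (next x)) w2); auto 6 using secH_subgroup, secH_dense].
    apply (St (next (next x)) w2); auto 6 using secH_subgroup, secH_dense.
    intros w3 R3 P3 Q3 H3 O3 C3.
    apply (Ev (next (next (next x))) w3); auto 8 using secH_subgroup, secH_dense.
    rewrite R3, P2, Q1. destruct (q1 w), (q2 w); simpl in *; congruence. }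
  induction n as [n IH] using (well_founded_induction lt_wf).
  apply Odd. clear Odd. intros x w H Ax SH DH HR Hw Ow Cw Rw.
  destruct (normal_form w) as (e & l & t & E & Hl & Ht & _ & _ & L3).
  assert (Rt : rt t = false).
  { destruct Ht as [-> | (y & -> & Ay)]; auto. simpl. now rewrite Ay. }
  assert (E' : w == erep l ++ t).
  { rewrite erep_rep, <- app_assoc. rewrite E.
    assert (Re : rt (erep l) = false) by now apply rt_erep.
    rewrite (weq_rt _ _ (erep_rep l)), rt_app, rt_pw in Re.
    rewrite (weq_rt _ _ E), !rt_app, rt_pw, Rt in Rw.
    replace (Nat.odd (length l)) with e; [reflexivity|].
    destruct e, (Nat.odd (length l)), (rt (rep l)); simpl in *; congruence. }
  destruct (le_lt_dec (length l + length t) 1) as [Sm | Lg].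
  - assert (exists y g, w == cj g [y] /\ isA y = false) as (y & g & Ey & Ay).
    { destruct l as [|y [|? ?]]; simpl in Sm; try lia.
      - destruct Ht as [-> | (y & -> & Ay)].
        + exfalso. destruct (weq_types _ _ E') as (_ & O1 & O2). destruct Ow as [O _].
          rewrite O1, O2 in O. now apply O.
        + exists y, []. split; auto.
      - destruct t; simpl in Sm; try lia. inversion Hl; subst.
        exists y, [La]. split; auto. }
    apply (Rf x y); auto.
    + intros <-. destruct Ow as [_ O]. apply O.
      destruct (weq_types _ _ Ey) as (_ & -> & ->). now rewrite q1_cj, q2_cj.
    + exists g. now apply (subE _ SH w).
  (* The classes 0 and that of [next x] form a subgroup, and the classes of the two sections add up
     to the shifted class of w, which is outside it; so one of them is outside. *)
  - assert (exists f, off (next x) (sec w f)) as (f & Of).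
    { destruct (sec_types w false) as (I1 & I2 & I3 & I4). simpl in *.
      unfold off in *. destruct Ow as [O1 O2].
      enough (forall p q r s, (p, q) <> (false, false) -> (p, q) <> (q1 [x], q2 [x]) ->
        exists f : bool,
         let q1f := if f then xorb s q else s in
         let q2f := if f then xorb (xorb (xorb r s) p) (xorb p q) else xorb (xorb r s) p in
         (q1f, q2f) <> (false, false) /\ (q1f, q2f) <> (q1 [next x], q2 [next x])) as C.
      { destruct (C (q1 w) (q2 w) (rt (sec w false)) (q1 (sec w false)) O1 O2) as (f & F).
        exists f. destruct f; rewrite ?I2, ?I3, I4; exact F. }
      clear - Ax. intros p q r s.
      destruct x, p, q; simpl; intros O1 O2; try discriminate; try congruence;
        destruct r, s; simpl;
        (exists true; simpl; split; congruence) || (exists false; simpl; split; congruence). }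
    apply (full_of_secH _ f SH DH).
    assert (Ef : sec w f == sec (erep l) f ++ sec t f).
    { rewrite (weq_secs _ _ f E'), sec_app, Rt. now rewrite xorb_false_r. }
    assert (Cf : cnt (sec (erep l) f ++ sec t f) < n).
    { rewrite cnt_app. pose proof (cnt_sec_erep l f Hl).
      assert (cnt (sec t f) <= Nat.b2n f * length t).
      { destruct Ht as [-> | (y & -> & Ay)]; simpl; [cbn; lia|].
        destruct f, y; try discriminate; cbn; lia. }
      assert (length t <= 1) by (destruct Ht as [-> | (? & -> & _)]; auto).
      destruct f; simpl in *; lia. }
    apply (IH _ Cf (next x) (sec (erep l) f ++ sec t f));
      auto using secH_subgroup, secH_dense.
    + exists w. splits; auto.
    + now apply (off_weq _ (sec w f)).
Qed.

(** * Pervova's theorem *)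

Notation allB := (Forall (fun x => isA x = false)).

Lemma length_gsec (x : gen) (e : bool) : length (gsec x e) <= 1.
Proof. destruct x, e; simpl; auto. Qed.

Lemma length_sec_erep (l : word) (e : bool) : allB l -> length (sec (erep l) e) <= length l.
Proof.
  intros Hl. induction Hl as [|x l Hx Hl IH]; auto.
  rewrite sec_erep_cons, length_app by auto.
  pose proof (length_gsec x (xorb e (Nat.even (length l)))). simpl. lia.
Qed.

(** Only d has an empty [low]; b and c contribute one letter to each section. *)
Lemma length_secs_erep (l : word) :
  allB l ->
  length (sec (erep l) false) + length (sec (erep l) true) <= 2 * length l /\
  (length (sec (erep l) false) + length (sec (erep l) true) = 2 * length l -> ~ In Ld l).
Proof.
  intros Hl. induction Hl as [|x l Hx Hl (IH & IHd)]; [simpl; auto|].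
  rewrite !sec_erep_cons, !length_app by auto. simpl length.
  split.
  - destruct x, (Nat.even (length l)); try discriminate; cbn in *; lia.
  - intros F [-> | I].
    + destruct (Nat.even (length l)); cbn in *; lia.
    + apply IHd; auto. destruct x, (Nat.even (length l)); try discriminate; cbn in *; lia.
Qed.

Lemma In_sec_erep (l : word) (e : bool) (u : gen) :
  allB l -> isA u = false -> In u (sec (erep l) e) -> exists v, In v l /\ u = next v.
Proof.
  intros Hl Hu. induction Hl as [|x l Hx Hl IH]; [intros I; destruct I|].
  rewrite sec_erep_cons by auto. intros I. apply in_app_or in I. destruct I as [I | I].
  - exists x. split; [now left|].
    destruct x, (xorb e (Nat.even (length l))); try discriminate; simpl in I;
      try contradiction; destruct I as [<- | []]; auto; discriminate.
  - destruct (IH I) as (v & Iv & Ev). exists v. split; auto. now right.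
Qed.

Lemma In_next_sec_erep (l : word) (v : gen) :
  allB l -> In v l -> exists e, In (next v) (sec (erep l) e).
Proof.
  intros Hl I. induction Hl as [|x l Hx Hl IH]; [destruct I|].
  destruct I as [<- | I].
  - exists (negb (Nat.even (length l))). rewrite sec_erep_cons by auto.
    apply in_or_app. left. unfold gsec. rewrite Hx.
    destruct (Nat.even (length l)); now left.
  - destruct (IH I) as (e & J). exists e. rewrite sec_erep_cons by auto.
    apply in_or_app. now right.
Qed.

Lemma secH_swap (H : word -> Prop) (w : word) :
  subgroup H -> H [La] -> secH true H w -> secH false H w.
Proof.
  intros SH Ha (h & Hh & Rh & Eh). exists (cj [La] h).
  rewrite rt_cj, sec_cj by auto. unfold cj at 2. simpl. rewrite app_nil_r.
  splits; auto. now apply sub_cj.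
Qed.

Lemma cj_commute (t : word) (z : gen) :
  isA z = false -> allB t -> cj t [z] == [z].
Proof.
  intros Hz Ht. induction Ht as [|x t Hx Ht IH]; [reflexivity|].
  change (x :: t) with ([x] ++ t). rewrite <- cj_cj, IH.
  destruct x, z; try discriminate; word_eq.
Qed.

(** In the normal form of w the last factor commutes with z and the leading power of a lies in [H].
    Equality of lengths means that nothing cancelled or merged. *)
Lemma cj_normal_form (H : word -> Prop) (w : word) (z : gen) :
  subgroup H -> H [La] -> isA z = false -> H (cj w [z]) ->
  exists l, allB l /\ H (cj (erep l) [z]) /\ 2 * length l <= length w /\
    (2 * length l = length w -> l = filter nonA w).
Proof.
  intros SH Ha Hz Hw. destruct (normal_form w) as (e & l & t & E & Hl & Ht & L1 & L2 & _).
  exists l. splits; auto; [|lia|intros; apply L2; destruct e; simpl in *; lia].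
  assert (Cz : cj t [z] == [z]).
  { apply cj_commute; auto. destruct Ht as [-> | (x & -> & Ax)]; auto. }
  apply (subE _ SH (cj (pw (Nat.odd (length l)) [La]) (cj (rev (pw e [La])) (cj w [z])))).
  - rewrite !cj_cj, E, erep_rep.
    transitivity (cj (pw (Nat.odd (length l)) [La] ++ rep l) (cj t [z])).
    + rewrite cj_cj. apply cj_proper; [grp | reflexivity].
    + now rewrite Cz.
  - apply sub_cj; auto; [now apply sub_pw|]. apply sub_cj; auto. apply subV; auto. now apply sub_pw.
Qed.

(* Conjugating by the section at 0 of [erep r] turns the conjugate of a coming from x into a. *)
Lemma contract (x y : gen) (r s : word) (H : word -> Prop) :
  subgroup H -> dense H -> H [La] -> x = Lb \/ x = Lc -> isA y = false ->
  allB r -> allB s -> H (cj (erep r) [x]) -> H (cj (erep s) [y]) ->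
  exists H' r' s', subgroup H' /\ dense H' /\ (full H' -> full H) /\ H' [La] /\
    allB r' /\ allB s' /\ H' (cj (erep r') [next x]) /\ H' (cj (erep s') [next y]) /\
    length r' <= length r /\
    (length r' = length r -> ~ In Ld r /\ (forall v, In v r -> In (next v) r') /\
       (forall u, In u r' -> exists v, In v r /\ u = next v)) /\
    2 * length s' <= length r + length s /\
    (Forall (eq Ld) s -> 2 * length s' <= length r).
Proof.
  intros SH DH Ha Hx Hy Hr Hs Cr Cs.
  assert (Ax : isA x = false) by (destruct Hx as [-> | ->]; auto).
  assert (Lx : low x = [La]) by (destruct Hx as [-> | ->]; auto).
  set (g := sec (erep r) false).
  set (H1 := secH false H). set (H' := conjH g H1).
  assert (S1 : subgroup H1) by now apply secH_subgroup.
  assert (S' : subgroup H') by now apply conjH_subgroup.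
  assert (Sec : forall l z e, allB l -> isA z = false -> H (cj (erep l) [z]) ->
    secH e H (cj (sec (erep l) e) (gsec z e))).
  { intros l z e Hl Hz Hc. exists (cj (erep l) [z]).
    rewrite rt_cj, sec_cj, rt_erep, xorb_false_r by (simpl; rewrite ?Hz; auto).
    splits; auto; [simpl; now rewrite Hz|]. simpl. now rewrite app_nil_r, xorb_false_r. }
  assert (Mv : forall u z, H1 (cj u [z]) -> H' (cj (rev g ++ u) [z])).
  { intros u z Hu. unfold H', conjH. apply (subE _ S1 (cj u [z])); auto.
    rewrite cj_cj. apply cj_proper; [grp | reflexivity]. }
  assert (Ha' : H' [La]).
  { unfold H', conjH. pose proof (Sec r x false Hr Ax Cr) as C.
    unfold gsec in C. now rewrite Ax, Lx in C. }
  (* As a lies in [H], sections at bit 1 may be used at bit 0. The conjugator has length at most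
     2|r|, and passing to its normal form halves this. *)
  assert (Cr' : H' (cj (rev g ++ sec (erep r) true) [next x])).
  { apply Mv, secH_swap; auto. pose proof (Sec r x true Hr Ax Cr) as C.
    unfold gsec in C. now rewrite Ax in C. }
  assert (Cs' : H' (cj (rev g ++ sec (erep s) true) [next y])).
  { apply Mv, secH_swap; auto. pose proof (Sec s y true Hs Hy Cs) as C.
    unfold gsec in C. now rewrite Hy in C. }
  assert (Anext : forall x, isA x = false -> isA (next x) = false) by now intros [].
  assert (Lg : length g <= length r) by now apply length_sec_erep.
  pose proof (length_secs_erep r Hr) as [LL LLd]. fold g in LL, LLd.
  destruct (cj_normal_form H' _ _ S' Ha' (Anext _ Ax) Cr') as (r' & Br' & Hr' & L1 & L2).
  rewrite length_app, length_rev in L1, L2.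
  assert (exists s', allB s' /\ H' (cj (erep s') [next y]) /\
    2 * length s' <= length r + length s /\ (Forall (eq Ld) s -> 2 * length s' <= length r))
    as (s' & Bs' & Hs' & M1 & M2).
  { assert (Dd : {Forall (eq Ld) s} + {~ Forall (eq Ld) s}).
    { apply Forall_dec. intros v. decide equality. }
    destruct Dd as [Ds | Ds].
    - destruct (cj_normal_form H' (rev g) (next y) S' Ha' (Anext _ Hy)) as (s' & Bs' & Hs' & M1 & _).
      { apply (subE _ S' (cj (rev g ++ sec (erep s) true) [next y])); auto.
        rewrite <- cj_cj. apply cj_proper; [reflexivity|]. apply cj_commute; auto.
        clear - Ds Hs. induction Ds as [|v l <- Ds IH]; [constructor|].
        inversion Hs; subst. rewrite sec_erep_cons by auto.
        destruct (Nat.even (length l)); simpl; auto. }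
      rewrite length_rev in M1. exists s'. splits; auto; lia.
    - destruct (cj_normal_form H' _ (next y) S' Ha' (Anext _ Hy) Cs') as (s' & Bs' & Hs' & M1 & _).
      pose proof (length_sec_erep s true Hs).
      rewrite length_app, length_rev in M1. exists s'. splits; auto; [lia|]. now intros. }
  exists H', r', s'. splits; auto.
  - apply conjH_dense; auto. now apply secH_dense.
  - intros F. apply (full_of_secH _ false SH DH). now apply (conjH_full g).
  - lia.
  - intros Er. assert (Er' : r' = filter nonA (rev g ++ sec (erep r) true)) by (apply L2; lia).
    assert (I' : forall u, In u r' <-> isA u = false /\ exists e, In u (sec (erep r) e)).
    { intros u. rewrite Er', filter_In, in_app_iff, <- in_rev. unfold g, nonA.
      rewrite negb_true_iff. split.
      - intros [[I | I] A]; split; auto; [now exists false | now exists true].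
      - intros [A ([] & I)]; auto. }
    splits.
    + apply LLd. lia.
    + intros v Iv. apply I'. split; [|now apply In_next_sec_erep].
      apply Anext. rewrite Forall_forall in Hr. now apply Hr.
    + intros u Iu. apply I' in Iu. destruct Iu as (Au & e & Iu). now apply (In_sec_erep r e).
Qed.

Definition config (x : gen) (m : nat) (H : word -> Prop) (r s : word) : Prop :=
  subgroup H /\ dense H /\ H [La] /\ allB r /\ allB s /\
  H (cj (erep r) [x]) /\ H (cj (erep s) [next x]) /\ length r <= m /\ length s <= m.

Lemma contract_left (x : gen) (m : nat) (H : word -> Prop) (r s : word) :
  x = Lb \/ x = Lc -> config x m H r s ->
  exists H' r' s', config (next x) m H' r' s' /\ (full H' -> full H) /\
    length r' <= length r /\
    (length r' = length r -> ~ In Ld r /\ (forall v, In v r -> In (next v) r') /\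
       (forall u, In u r' -> exists v, In v r /\ u = next v)) /\
    2 * length s' <= length r + length s.
Proof.
  intros Hx (SH & DH & Ha & Br & Bs & Hr & Hs & Lr & Ls).
  destruct (contract x (next x) r s H) as (H' & r' & s' & C); auto.
  { destruct Hx as [-> | ->]; auto. }
  exists H', r', s'. unfold config. intuition lia.
Qed.

(** In the pair d, b only b has the section a at bit 0, so the roles of r and s are exchanged. *)
Lemma contract_right (m : nat) (H : word -> Prop) (r s : word) :
  config Ld m H r s ->
  exists H' r' s', config Lb m H' r' s' /\ (full H' -> full H) /\
    length s' <= length s /\ 2 * length r' <= length s + length r /\
    (Forall (eq Ld) r -> 2 * length r' <= length s).
Proof.
  intros (SH & DH & Ha & Br & Bs & Hr & Hs & Lr & Ls).
  destruct (contract Lb Ld s r H) as (H' & s' & r' & C); auto.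
  exists H', r', s'. unfold config. intuition lia.
Qed.

Lemma config_weaken (x : gen) (m m' : nat) (H : word -> Prop) (r s : word) :
  config x m H r s -> length r <= m' -> length s <= m' -> config x m' H r s.
Proof. unfold config. intuition. Qed.

(** If r keeps its length in a round, it contains no d, and its letters advance along b -> c -> d.
    After two such rounds r consists of d only, and the third round shortens it. Once r is below the
    bound, the averaging estimate for s brings s below it in the next left contraction. *)
Lemma config_full (m : nat) (H : word -> Prop) (r s : word) : config Lb m H r s -> full H.
Proof.
  revert H r s; induction m as [|m IHb]; intros H r s C.
  { destruct C as (SH & DH & Ha & _ & _ & Hr & Hs & Lr & Ls).
    destruct r, s; simpl in Lr, Ls; try lia.
    apply full_of_gens; auto. intros []; auto.
    apply (subE _ SH (cj [] [Lb] ++ cj [] [Lc])); [word_eq | now apply subM]. }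
  assert (IHd : forall H r s, config Ld m H r s -> full H).
  { intros H0 r0 s0 C0. destruct (contract_right _ _ _ _ C0) as (H1 & r1 & s1 & C1 & F & _).
    apply F. now apply (IHb _ r1 s1). }
  assert (IHc : forall H r s, config Lc m H r s -> full H).
  { intros H0 r0 s0 C0. destruct (contract_left Lc _ _ _ _ (or_intror eq_refl) C0)
      as (H1 & r1 & s1 & C1 & F & _). apply F. now apply (IHd _ r1 s1). }
  assert (Short : forall H r s, config Lb (S m) H r s -> length r <= m -> full H).
  { intros H0 r0 s0 C0 L0. destruct (contract_left Lb _ _ _ _ (or_introl eq_refl) C0)
      as (H1 & r1 & s1 & C1 & F & L1 & _ & L2). apply F. apply (IHc _ r1 s1).
    apply (config_weaken _ _ _ _ _ _ C1); [lia|]. destruct C0 as (_ & _ & _ & _ & _ & _ & _ & ? & ?). lia. }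
  destruct (le_lt_dec (length r) m) as [Lr | Lr]; [now apply (Short _ r s)|].
  pose proof C as (_ & _ & _ & Br & _ & _ & _ & Mr & Ms).
  destruct (contract_left Lb _ _ _ _ (or_introl eq_refl) C)
    as (H1 & r1 & s1 & C1 & F1 & L1 & E1 & M1). apply F1. simpl in C1.
  pose proof C1 as (_ & _ & _ & Br1 & _ & _ & _ & Mr1 & Ms1).
  destruct (contract_left Lc _ _ _ _ (or_intror eq_refl) C1)
    as (H2 & r2 & s2 & C2 & F2 & L2 & E2 & M2). apply F2. simpl in C2.
  pose proof C2 as (_ & _ & _ & Br2 & _ & _ & _ & Mr2 & Ms2).
  destruct (le_lt_dec (length r1) m) as [Lr1 | Lr1].
  { apply (IHd _ r2 s2). apply (config_weaken _ _ _ _ _ _ C2); lia. }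
  destruct (contract_right _ _ _ _ C2) as (H3 & r3 & s3 & C3 & F3 & M3 & L3 & E3). apply F3.
  apply (Short _ r3 s3 C3).
  destruct (le_lt_dec (length r2) m) as [Lr2 | Lr2]; [lia|].
  destruct E1 as (D1 & I1 & J1); [lia|]. destruct E2 as (D2 & I2 & J2); [lia|].
  assert (All : Forall (eq Ld) r2).
  { apply Forall_forall. intros u Iu. destruct (J2 u Iu) as (v & Iv & ->).
    destruct (J1 v Iv) as (w & Iw & ->).
    rewrite Forall_forall in Br. specialize (Br w Iw).
    destruct w; try discriminate; auto; exfalso; [|now apply D1].
    apply D2. exact (I1 Lc Iw). }
  specialize (E3 All). lia.
Qed.

(** A conjugate of b has conjugates of a and of c as sections, so one step turns the pair d, b into
    b, c together with a; the other pairs reach d, b by passing to sections. *)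
Lemma pair_full (x : gen) (H : word -> Prop) :
  isA x = false -> subgroup H -> dense H -> has_cj x H -> has_cj (next x) H -> full H.
Proof.
  assert (D : forall H, subgroup H -> dense H -> has_cj Ld H -> has_cj Lb H -> full H).
  { clear. intros H SH DH Hd (g & Hg).
    apply (full_of_secH _ false SH DH).
    destruct (has_cj_secH Ld false H eq_refl SH DH Hd) as (gb & Hb).
    destruct (secH_cj H g [Lb] false true SH DH eq_refl Hg) as (gc & Hc).
    destruct (secH_cj H g [Lb] false false SH DH eq_refl Hg) as (k & Ha).
    change (secH false H (cj gc [Lc])) in Hc. change (secH false H (cj k [La])) in Ha.
    simpl in Hb.
    set (H1 := secH false H) in *. assert (S1 : subgroup H1) by now apply secH_subgroup.
    assert (D1 : dense H1) by now apply secH_dense.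
    apply (conjH_full k); auto. set (H2 := conjH k H1).
    assert (S2 : subgroup H2) by now apply conjH_subgroup.
    assert (Mv : forall u z, H1 (cj u [z]) -> H2 (cj (rev k ++ u) [z])).
    { intros u z Hu. unfold H2, conjH. apply (subE _ S1 (cj u [z])); auto.
      rewrite cj_cj. apply cj_proper; [grp | reflexivity]. }
    assert (Ha2 : H2 [La]) by exact Ha.
    destruct (cj_normal_form H2 _ Lb S2 Ha2 eq_refl (Mv _ _ Hb)) as (r & Br & Hr & _).
    destruct (cj_normal_form H2 _ Lc S2 Ha2 eq_refl (Mv _ _ Hc)) as (s & Bs & Hs & _).
    apply (config_full (length r + length s) H2 r s).
    unfold config. splits; auto; try lia. now apply conjH_dense. }
  assert (C : forall H, subgroup H -> dense H -> has_cj Lc H -> has_cj Ld H -> full H).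
  { clear - D. intros H SH DH Hc Hd. apply (full_of_secH _ false SH DH).
    apply D; auto using secH_subgroup, secH_dense.
    - now apply (has_cj_secH Lc).
    - now apply (has_cj_secH Ld). }
  intros Hx SH DH H1 H2. destruct x; try discriminate; auto.
  apply (full_of_secH _ false SH DH).
  apply C; auto using secH_subgroup, secH_dense.
  - now apply (has_cj_secH Lb).
  - now apply (has_cj_secH Lc).
Qed.

(** [find_letter] is used twice: with the trivial relation it finds one letter up to conjugacy, and
    with [has_cj] it carries that letter along the sections while finding a second one. *)
Theorem dense_full (H : word -> Prop) : subgroup H -> dense H -> full H.
Proof.
  assert (Second : forall x H, isA x = false -> subgroup H -> dense H -> has_cj x H -> full H).
  { clear. intros x H Ax SH DH Hx.
    destruct (DH false (q1 [next x]) (q2 [next x])) as (w & Hw & _ & Q1 & Q2).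
    apply (find_letter has_cj) with (n := cnt w) (x := x) (w := w); auto.
    - intros; now apply has_cj_secH.
    - intros y z X Ay Az N SX DX Hy Hz.
      assert (z = next y \/ y = next z) as [-> | ->]
        by (destruct y, z; try discriminate; auto; congruence).
      + now apply (pair_full y).
      + now apply (pair_full z).
    - unfold off. rewrite Q1, Q2. destruct x; try discriminate; simpl; split; congruence. }
  intros SH DH. destruct (DH false true false) as (w & Hw & _ & Q1 & Q2).
  apply (find_letter (fun _ _ => True)) with (n := cnt w) (x := Lb) (w := w); auto.
  - intros y z X _ Az _ SX DX _ Hz. now apply (Second z).
  - unfold off. rewrite Q1, Q2. simpl. split; congruence.
Qed.

(** * Connectivity *)

Definition ovr (s : nat -> word) (j : nat) (u : word) : nat -> word :=
  fun i => if i =? j then u else s i.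

Lemma ovr_eq (s : nat -> word) (j : nat) (u : word) : ovr s j u j = u.
Proof. unfold ovr. now rewrite Nat.eqb_refl. Qed.
Lemma ovr_neq (s : nat -> word) (i j : nat) (u : word) : i <> j -> ovr s j u i = s i.
Proof. intros H. unfold ovr. apply Nat.eqb_neq in H. now rewrite H. Qed.

(* The move (i, j, b, l) multiplies entry j by entry i, inverted if b, on the left if l. *)
Definition move : Type := nat * nat * bool * bool.
Definition valid (n : nat) (m : move) : Prop :=
  let '(i, j, _, _) := m in i < n /\ j < n /\ i <> j.
Definition act1 (s : nat -> word) (m : move) : nat -> word :=
  let '(i, j, b, l) := m in
  let u := if b then rev (s i) else s i in ovr s j (if l then u ++ s j else s j ++ u).
Definition act (ms : list move) (s : nat -> word) : nat -> word := fold_left act1 ms s.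

Definition agree (n : nat) (s s' : nat -> word) : Prop := forall i, i < n -> s i == s' i.
Definition conn (n : nat) (s s' : nat -> word) : Prop :=
  exists ms, Forall (valid n) ms /\ agree n (act ms s) s'.

Lemma agree_refl (n : nat) (s : nat -> word) : agree n s s.
Proof. intros i _. reflexivity. Qed.
Lemma agree_trans (n : nat) (s s' s'' : nat -> word) :
  agree n s s' -> agree n s' s'' -> agree n s s''.
Proof. intros H K i Hi. now rewrite (H i Hi), (K i Hi). Qed.
Lemma agree_sym (n : nat) (s s' : nat -> word) : agree n s s' -> agree n s' s.
Proof. intros H i Hi. now rewrite (H i Hi). Qed.

Lemma act1_agree (n : nat) (m : move) (s s' : nat -> word) :
  valid n m -> agree n s s' -> agree n (act1 s m) (act1 s' m).
Proof.
  destruct m as [[[i j] b] l]. intros (Hi & Hj & _) A k Hk. simpl.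
  destruct (Nat.eq_dec k j) as [->|N]; [|rewrite !ovr_neq; auto].
  rewrite !ovr_eq. destruct b, l; now rewrite (A j Hj), (A i Hi).
Qed.

Lemma act_agree (n : nat) (ms : list move) (s s' : nat -> word) :
  Forall (valid n) ms -> agree n s s' -> agree n (act ms s) (act ms s').
Proof.
  intros V. revert s s'. induction V as [|m ms Vm V IH]; intros s s' A; auto.
  apply IH. now apply act1_agree.
Qed.

Lemma conn_of_agree (n : nat) (s s' : nat -> word) : agree n s s' -> conn n s s'.
Proof. exists []. split; auto. Qed.

Lemma conn_trans (n : nat) (s s' s'' : nat -> word) :
  conn n s s' -> conn n s' s'' -> conn n s s''.
Proof.
  intros (ms & V & A) (ms' & V' & A'). exists (ms ++ ms').
  split; [now apply Forall_app|]. unfold act. rewrite fold_left_app.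
  apply (agree_trans _ _ (act ms' s')); auto. now apply act_agree.
Qed.

Lemma conn_sym (n : nat) (s s' : nat -> word) : conn n s s' -> conn n s' s.
Proof.
  intros (ms & V & A). revert s A. induction V as [|m ms Vm V IH]; intros s A.
  - apply conn_of_agree. now apply agree_sym.
  - apply (conn_trans _ _ (act1 s m)); [now apply IH|].
    destruct m as [[[i j] b] l]. destruct Vm as (Hi & Hj & N).
    exists [(i, j, negb b, l)]. split; [repeat constructor; auto|].
    intros k Hk. simpl. destruct (Nat.eq_dec k j) as [->|N']; [|rewrite !ovr_neq; auto; reflexivity].
    rewrite !ovr_eq, ovr_neq by auto. destruct b, l; simpl; grp.
Qed.

Inductive generated (P : nat -> Prop) (s : nat -> word) : word -> Prop :=
| gen_1 : generated P s []
| gen_g i : P i -> generated P s (s i)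
| gen_M u v : generated P s u -> generated P s v -> generated P s (u ++ v)
| gen_V u : generated P s u -> generated P s (rev u)
| gen_E u v : u == v -> generated P s u -> generated P s v.

Lemma generated_subgroup (P : nat -> Prop) (s : nat -> word) : subgroup (generated P s).
Proof. split; [apply gen_1 | apply gen_M | apply gen_V | apply gen_E]. Qed.

Lemma generated_least (P : nat -> Prop) (s : nat -> word) (H : word -> Prop) :
  subgroup H -> (forall i, P i -> H (s i)) -> forall w, generated P s w -> H w.
Proof.
  intros SH HP w G. induction G; auto.
  - now apply sub1.
  - now apply subM.
  - now apply subV.
  - now apply (subE _ SH u).
Qed.

Definition Full (n : nat) (s : nat -> word) : Prop := full (generated (fun i => i < n) s).
Definition others (n j : nat) : nat -> Prop := fun i => i < n /\ i <> j.

Lemma Full_act1 (n : nat) (m : move) (s : nat -> word) :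
  valid n m -> Full n s -> Full n (act1 s m).
Proof.
  destruct m as [[[i j] b] l]. intros (Hi & Hj & N) F w. specialize (F w). revert w F.
  apply generated_least; [apply generated_subgroup|]. intros k Hk.
  set (s' := act1 s (i, j, b, l)).
  assert (G : forall k, k < n -> generated (fun i => i < n) s' (s' k))
    by (intros; now apply gen_g).
  destruct (Nat.eq_dec k j) as [->|N'].
  - pose proof (G i Hi) as Gi. pose proof (G j Hj) as Gj. unfold s' in Gi, Gj at 2.
    simpl in Gi, Gj. rewrite ovr_eq in Gj. rewrite ovr_neq in Gi by auto.
    set (u := if b then rev (s i) else s i) in *.
    assert (Gu : generated (fun i => i < n) s' (rev u)).
    { unfold u. destruct b; auto using gen_V. }
    destruct l.
    + refine (gen_E _ _ _ _ _ (gen_M _ _ _ _ Gu Gj)). apply rev_mul_l.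
    + refine (gen_E _ _ _ _ _ (gen_M _ _ _ _ Gj Gu)). grp.
  - replace (s k) with (s' k); auto. unfold s'. simpl. now rewrite ovr_neq.
Qed.

Lemma Full_agree (n : nat) (s s' : nat -> word) : agree n s s' -> Full n s -> Full n s'.
Proof.
  intros A F w. specialize (F w). revert w F.
  apply generated_least; [apply generated_subgroup|]. intros k Hk.
  apply (gen_E _ _ (s' k)); [symmetry; now apply A | now apply gen_g].
Qed.

Lemma Full_conn (n : nat) (s s' : nat -> word) : conn n s s' -> Full n s -> Full n s'.
Proof.
  intros (ms & V & A) F. apply (Full_agree n (act ms s)); auto. clear s' A.
  revert s F. induction V as [|m ms Vm V IH]; intros s F; auto.
  apply IH. now apply Full_act1.
Qed.

Lemma ovr_ovr (n : nat) (s : nat -> word) (j : nat) (u v v' : word) :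
  v == v' -> agree n (ovr (ovr s j u) j v) (ovr s j v').
Proof.
  intros E i _. destruct (Nat.eq_dec i j) as [->|N]; [now rewrite !ovr_eq|].
  rewrite !ovr_neq; auto. reflexivity.
Qed.

(** Quantifying over all s that agree with [s0] off j lets the moves be composed, as they change
    entry j only; the inverse is carried along to cover [gen_V]. *)
Lemma conn_mul (n j : nat) (s0 : nat -> word) (u : word) :
  j < n -> generated (others n j) s0 u ->
  forall s, (forall i, i <> j -> s i = s0 i) ->
  conn n s (ovr s j (s j ++ u)) /\ conn n s (ovr s j (s j ++ rev u)).
Proof.
  intros Hj G. induction G as [|i (Hi & N)|u v _ IHu _ IHv|u _ IH|u v E _ IH]; intros s A.
  - simpl. rewrite app_nil_r.
    enough (agree n s (ovr s j (s j))) by (split; now apply conn_of_agree).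
    intros i _. destruct (Nat.eq_dec i j) as [->|N]; [now rewrite ovr_eq|].
    rewrite ovr_neq; auto. reflexivity.
  - rewrite <- (A i N). split; [exists [(i, j, false, false)] | exists [(i, j, true, false)]];
      (split; [repeat constructor; auto | apply agree_refl]).
  - rewrite rev_app_distr.
    assert (C : forall x y, (forall t, (forall i, i <> j -> t i = s0 i) -> conn n t (ovr t j (t j ++ x))) ->
      (forall t, (forall i, i <> j -> t i = s0 i) -> conn n t (ovr t j (t j ++ y))) ->
      conn n s (ovr s j (s j ++ x ++ y))).
    { intros x y Cx Cy. apply (conn_trans _ _ _ _ (Cx s A)).
      eapply conn_trans; [apply (Cy (ovr s j (s j ++ x)))|].
      - intros i N. rewrite ovr_neq; auto.
      - apply conn_of_agree. apply ovr_ovr. rewrite ovr_eq. now rewrite app_assoc. }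
    split; apply C; intros t At; now (apply IHu || apply IHv).
  - rewrite rev_involutive. destruct (IH s A). now split.
  - destruct (IH s A) as [C C'].
    split; [apply (conn_trans _ _ _ _ C) | apply (conn_trans _ _ _ _ C')];
      apply conn_of_agree; intros i _;
      (destruct (Nat.eq_dec i j) as [->|N]; [rewrite !ovr_eq; now rewrite E|]);
      rewrite !ovr_neq; auto; reflexivity.
Qed.

Lemma set_slot (n j : nat) (s : nat -> word) (y : word) :
  j < n -> full (generated (others n j) s) -> conn n s (ovr s j y).
Proof.
  intros Hj F.
  destruct (conn_mul n j s (rev (s j) ++ y) Hj (F _) s (fun _ _ => eq_refl)) as [C _].
  apply (conn_trans _ _ _ _ C). apply conn_of_agree. intros i _.
  destruct (Nat.eq_dec i j) as [->|N]; [|rewrite !ovr_neq; auto; reflexivity].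
  rewrite !ovr_eq. apply mul_rev_l.
Qed.

(** * Linear algebra in the abelianization F_2^3 *)

Definition ty : Type := bool * bool * bool.
Definition tyw (w : word) : ty := (rt w, q1 w, q2 w).
Definition add (t t' : ty) : ty :=
  let '(x, y, z) := t in let '(x', y', z') := t' in (xorb x x', xorb y y', xorb z z').
Definition scale (c : bool) (t : ty) : ty := if c then t else (false, false, false).
Definition comb (c1 c2 c3 : bool) (t1 t2 t3 : ty) : ty :=
  add (scale c1 t1) (add (scale c2 t2) (scale c3 t3)).
Definition pairing (t t' : ty) : bool :=
  let '(x, y, z) := t in let '(x', y', z') := t' in xorb (x && x') (xorb (y && y') (z && z')).

Definition zero : ty := (false, false, false).
Definition indep (t1 t2 t3 : ty) : Prop :=
  t1 <> zero /\ (forall c, t2 <> scale c t1) /\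
  (forall c c', t3 <> add (scale c t1) (scale c' t2)).

Lemma functional1 (t1 : ty) :
  exists f, f <> zero /\ pairing f t1 = false.
Proof.
  destruct t1 as [[[] []] []];
    (exists (true, false, false); split; [discriminate | reflexivity]) ||
    (exists (false, true, false); split; [discriminate | reflexivity]) ||
    (exists (false, false, true); split; [discriminate | reflexivity]) ||
    (exists (true, true, false); split; [discriminate | reflexivity]).
Qed.

Lemma functional2 (t1 t2 : ty) :
  exists f, f <> zero /\ pairing f t1 = false /\ pairing f t2 = false.
Proof.
  destruct t1 as [[[] []] []], t2 as [[[] []] []];
    (exists (true, false, false); now splits) || (exists (false, true, false); now splits) ||
    (exists (false, false, true); now splits) || (exists (true, true, false); now splits) ||
    (exists (true, false, true); now splits) || (exists (false, true, true); now splits) ||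
    (exists (true, true, true); now splits).
Qed.

Lemma pairing_scale (f t : ty) (c : bool) : pairing f (scale c t) = c && pairing f t.
Proof. destruct f as [[[] []] []], t as [[? ?] ?], c; reflexivity. Qed.

Lemma pairing_add (f t t' : ty) : pairing f (add t t') = xorb (pairing f t) (pairing f t').
Proof.
  destruct f as [[[] []] []], t as [[[] []] []], t' as [[[] []] []]; reflexivity.
Qed.

Definition det (t1 t2 t3 : ty) : bool :=
  let '(x1, y1, z1) := t1 in let '(x2, y2, z2) := t2 in let '(x3, y3, z3) := t3 in
  xorb (x1 && xorb (y2 && z3) (y3 && z2))
    (xorb (y1 && xorb (x2 && z3) (x3 && z2)) (z1 && xorb (x2 && y3) (x3 && y2))).

Lemma cramer (t1 t2 t3 t : ty) :
  comb (det t t2 t3) (det t1 t t3) (det t1 t2 t) t1 t2 t3 = scale (det t1 t2 t3) t.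
Proof.
  destruct t1 as [[x1 y1] z1], t2 as [[x2 y2] z2], t3 as [[x3 y3] z3], t as [[x y] z].
  assert (S : forall c x y z, scale c (x, y, z) = (c && x, c && y, c && z)) by now intros [].
  unfold comb. rewrite !S. unfold add, det. f_equal; [f_equal|]; btauto.
Qed.

Lemma indep_det (t1 t2 t3 : ty) : indep t1 t2 t3 -> det t1 t2 t3 = true.
Proof.
  intros (I1 & I2 & I3).
  destruct t1 as [[[] []] []], t2 as [[[] []] []]; destruct t3 as [[[] []] []]; try reflexivity; exfalso;
    first [ now apply I1 | now apply (I2 false) | now apply (I2 true)
          | now apply (I3 false false) | now apply (I3 false true)
          | now apply (I3 true false) | now apply (I3 true true) ].
Qed.

Lemma indep_comb (t1 t2 t3 t : ty) :
  indep t1 t2 t3 -> exists c1 c2 c3, comb c1 c2 c3 t1 t2 t3 = t.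
Proof.
  intros I. apply indep_det in I. exists (det t t2 t3), (det t1 t t3), (det t1 t2 t).
  now rewrite cramer, I.
Qed.

Lemma tyw_app (u v : word) : tyw (u ++ v) = add (tyw u) (tyw v).
Proof. unfold tyw. now rewrite rt_app, q1_app, q2_app. Qed.

Lemma tyw_pw (c : bool) (w : word) : tyw (pw c w) = scale c (tyw w).
Proof. now destruct c. Qed.

(** Otherwise all of G would lie in the kernel of a nonzero functional on its abelianization. *)
Lemma Full_functional (n : nat) (s : nat -> word) (f : ty) :
  Full n s -> f <> zero -> exists i, i < n /\ pairing f (tyw (s i)) = true.
Proof.
  intros F N. destruct (existsb (fun i => pairing f (tyw (s i))) (seq 0 n)) eqn:E.
  - apply existsb_exists in E. destruct E as (i & Hi & P). apply in_seq in Hi.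
    exists i. split; auto. lia.
  - exfalso.
    assert (Z : forall w, pairing f (tyw w) = false).
    { intros w. specialize (F w). revert w F. apply generated_least.
      - split.
        + now destruct f as [[[] []] []].
        + intros u v Hu Hv. now rewrite tyw_app, pairing_add, Hu, Hv.
        + intros u Hu. unfold tyw. now rewrite rt_rev, q1_rev, q2_rev.
        + intros u v Euv Hu. unfold tyw. destruct (weq_types _ _ Euv) as (<- & <- & <-). exact Hu.
      - intros i Hi. destruct (pairing f (tyw (s i))) eqn:P; auto.
        rewrite <- E. symmetry. apply existsb_exists. exists i. split; auto. apply in_seq. lia. }
    apply N. pose proof (Z [La]) as Za. pose proof (Z [Lc]) as Zc. pose proof (Z [Ld]) as Zd.
    destruct f as [[[] []] []]; try reflexivity; discriminate.
Qed.

Definition basis (n : nat) (s : nat -> word) (i1 i2 i3 : nat) : Prop :=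
  i1 < n /\ i2 < n /\ i3 < n /\ indep (tyw (s i1)) (tyw (s i2)) (tyw (s i3)).

Lemma extend1 (n : nat) (s : nat -> word) :
  Full n s -> exists i, i < n /\ tyw (s i) <> zero.
Proof.
  intros F. destruct (Full_functional n s (true, false, false) F) as (i & Hi & P); [discriminate|].
  exists i. split; auto. intros E. now rewrite E in P.
Qed.

Lemma extend2 (n : nat) (s : nat -> word) (t1 : ty) :
  Full n s -> exists i, i < n /\ forall c, tyw (s i) <> scale c t1.
Proof.
  intros F. destruct (functional1 t1) as (f & N & P1).
  destruct (Full_functional n s f F N) as (i & Hi & P).
  exists i. split; auto. intros c E. rewrite E, pairing_scale, P1 in P. now destruct c.
Qed.

Lemma extend3 (n : nat) (s : nat -> word) (t1 t2 : ty) :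
  Full n s -> exists i, i < n /\ forall c c', tyw (s i) <> add (scale c t1) (scale c' t2).
Proof.
  intros F. destruct (functional2 t1 t2) as (f & N & P1 & P2).
  destruct (Full_functional n s f F N) as (i & Hi & P).
  exists i. split; auto. intros c c' E.
  rewrite E, pairing_add, !pairing_scale, P1, P2 in P. now destruct c, c'.
Qed.

Lemma others_full (n j : nat) (s : nat -> word) (i1 i2 i3 : nat) :
  basis n s i1 i2 i3 -> i1 <> j -> i2 <> j -> i3 <> j -> full (generated (others n j) s).
Proof.
  intros (H1 & H2 & H3 & I) N1 N2 N3.
  pose proof (generated_subgroup (others n j) s) as SG.
  assert (G : forall i, i < n -> i <> j -> generated (others n j) s (s i)).
  { intros. apply gen_g. now split. }
  apply dense_full; auto. intros x y z.
  destruct (indep_comb _ _ _ (x, y, z) I) as (c1 & c2 & c3 & E).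
  exists (pw c1 (s i1) ++ pw c2 (s i2) ++ pw c3 (s i3)). split.
  - repeat apply gen_M; apply sub_pw; auto.
  - unfold comb in E. rewrite <- !tyw_pw, <- !tyw_app in E. unfold tyw in E.
    now injection E as -> -> ->.
Qed.

Lemma spare_index (i1 i2 i3 : nat) : exists j, j < 4 /\ j <> i1 /\ j <> i2 /\ j <> i3.
Proof.
  destruct i1 as [|[|[|i1]]], i2 as [|[|[|i2]]], i3 as [|[|[|i3]]];
    (exists 0; lia) || (exists 1; lia) || (exists 2; lia) || (exists 3; lia).
Qed.

(* If entry p belongs to the basis, a copy of it is first stored in an entry off the basis. *)
Lemma free_slot (n : nat) (s : nat -> word) (i1 i2 i3 p : nat) (y : word) :
  4 <= n -> basis n s i1 i2 i3 -> p < n ->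
  exists s', conn n s s' /\ s' p = y /\ forall i, In i [i1; i2; i3] -> i <> p -> s' i = s i.
Proof.
  intros Hn B Hp.
  destruct (in_dec Nat.eq_dec p [i1; i2; i3]) as [I | I].
  - destruct (spare_index i1 i2 i3) as (j & Hj & N1 & N2 & N3).
    set (s1 := ovr s j (s p)).
    assert (C1 : conn n s s1).
    { apply set_slot; [lia|]. apply (others_full _ _ _ i1 i2 i3); auto. }
    (* Redirecting p to its copy at j yields a basis that avoids p. *)
    set (g i := if i =? p then j else i).
    assert (Sg : forall i, i <> j -> s1 (g i) = s i).
    { intros i N. unfold g, s1. destruct (Nat.eqb_spec i p) as [->|N'].
      - apply ovr_eq.
      - now apply ovr_neq. }
    assert (Gp : forall i, g i <> p).
    { intros i. unfold g. destruct (Nat.eqb_spec i p); auto.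
      intros ->. simpl in I. intuition congruence. }
    assert (Gn : forall i, i < n -> g i < n).
    { intros i Hi. unfold g. destruct (i =? p); lia. }
    exists (ovr s1 p y). splits.
    + apply (conn_trans _ _ _ _ C1). apply set_slot; auto.
      apply (others_full _ _ _ (g i1) (g i2) (g i3)); auto.
      destruct B as (H1 & H2 & H3 & B). unfold basis. rewrite !Sg by auto. splits; auto.
    + apply ovr_eq.
    + intros i Ii N. rewrite ovr_neq by auto. apply ovr_neq.
      simpl in Ii. intuition congruence.
  - exists (ovr s p y). simpl in I. splits.
    + apply set_slot; auto. apply (others_full _ _ _ i1 i2 i3); auto; intuition.
    + apply ovr_eq.
    + intros i _ N. now apply ovr_neq.
Qed.

Definition base (i : nat) : word :=
  match i with 0 => [La] | 1 => [Lc] | 2 => [Ld] | _ => [] end.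

(** Each basis is extended from the entries already set, so [free_slot] leaves these untouched. *)
Lemma conn_base (n : nat) (s : nat -> word) : 4 <= n -> Full n s -> conn n s base.
Proof.
  intros Hn F.
  destruct (extend1 n s F) as (i1 & H1 & T1).
  destruct (extend2 n s (tyw (s i1)) F) as (i2 & H2 & T2).
  destruct (extend3 n s (tyw (s i1)) (tyw (s i2)) F) as (i3 & H3 & T3).
  destruct (free_slot n s i1 i2 i3 0 [La] Hn) as (s1 & C1 & E10 & _);
    [unfold basis, indep; now splits | lia |].
  pose proof (Full_conn _ _ _ C1 F) as F1.
  assert (T10 : tyw (s1 0) <> zero) by (rewrite E10; discriminate).
  destruct (extend2 n s1 (tyw (s1 0)) F1) as (j2 & J2 & U2).
  destruct (extend3 n s1 (tyw (s1 0)) (tyw (s1 j2)) F1) as (j3 & J3 & U3).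
  destruct (free_slot n s1 0 j2 j3 1 [Lc] Hn) as (s2 & C2 & E21 & K2);
    [unfold basis, indep; splits; auto; lia | lia |].
  assert (E20 : s2 0 = [La]) by (rewrite <- E10; apply K2; simpl; auto).
  pose proof (Full_conn _ _ _ C2 F1) as F2.
  assert (T21 : forall c, tyw (s2 1) <> scale c (tyw (s2 0))).
  { intros c. rewrite E21, E20. now destruct c. }
  assert (T20 : tyw (s2 0) <> zero) by (rewrite E20; discriminate).
  destruct (extend3 n s2 (tyw (s2 0)) (tyw (s2 1)) F2) as (k3 & K3 & V3).
  destruct (free_slot n s2 0 1 k3 2 [Ld] Hn) as (s3 & C3 & E32 & K4);
    [unfold basis, indep; splits; auto; lia | lia |].
  assert (E30 : s3 0 = [La]) by (rewrite <- E20; apply K4; simpl; auto).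
  assert (E31 : s3 1 = [Lc]) by (rewrite <- E21; apply K4; simpl; auto).
  assert (Fill : forall k, 3 + k <= n -> exists s', conn n s3 s' /\
    forall i, i < 3 + k -> s' i = base i).
  { induction k as [|k IH]; intros Hk.
    - exists s3. split; [apply conn_of_agree, agree_refl|].
      intros [|[|[|i]]] Hi; auto; lia.
    - destruct IH as (s' & C & E); [lia|].
      exists (ovr s' (3 + k) []). split.
      + apply (conn_trans _ _ _ _ C). apply set_slot; [lia|].
        apply (others_full _ _ _ 0 1 2); try lia.
        unfold basis, indep. rewrite !E by lia.
        splits; try lia; [discriminate | now intros [] | now intros [] []].
      + intros i Hi. destruct (Nat.eq_dec i (3 + k)) as [->|N].
        * now rewrite ovr_eq.
        * rewrite ovr_neq by auto. apply E. lia. }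
  destruct (Fill (n - 3)) as (s4 & C4 & E4); [lia|].
  apply (conn_trans _ _ _ _ C1), (conn_trans _ _ _ _ C2), (conn_trans _ _ _ _ C3),
    (conn_trans _ _ _ _ C4), conn_of_agree.
  intros i Hi. rewrite E4 by lia. reflexivity.
Qed.

Lemma conn_all (n : nat) (s s' : nat -> word) :
  4 <= n -> Full n s -> Full n s' -> conn n s s'.
Proof.
  intros Hn F F'. apply (conn_trans _ _ base); [|apply conn_sym]; now apply conn_base.
Qed.

(** * From words to automorphisms of the tree *)

Definition tup (n : nat) (s : nat -> word) : list tfun := map (fun i => eval (s i)) (seq 0 n).

Lemma eval_weq (u v : word) : u == v <-> eval u = eval v.
Proof. split; [intros H; extensionality x; apply H | intros H x; now rewrite H]. Qed.

Lemma nth_tup (n i : nat) (s : nat -> word) (d : tfun) : i < n -> nth i (tup n s) d = eval (s i).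
Proof.
  intros Hi. unfold tup. rewrite nth_indep with (d' := eval (s 0)).
  - rewrite map_nth with (f := fun i => eval (s i)). now rewrite seq_nth.
  - now rewrite length_map, length_seq.
Qed.

Lemma tup_agree (n : nat) (s s' : nat -> word) : agree n s s' -> tup n s = tup n s'.
Proof.
  intros A. apply map_ext_in. intros i Hi. apply in_seq in Hi. apply eval_weq, A. lia.
Qed.

Lemma upd_map_seq (f : nat -> tfun) (a k j : nat) (y : tfun) :
  upd (map f (seq a k)) j y = map (fun i => if i =? a + j then y else f i) (seq a k).
Proof.
  revert a j; induction k as [|k IH]; intros a j; [now destruct j|].
  destruct j as [|j]; simpl.
  - rewrite Nat.add_0_r, Nat.eqb_refl. f_equal. apply map_ext_in. intros i Hi.
    apply in_seq in Hi. destruct (Nat.eqb_spec i a); auto. lia.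
  - rewrite IH. destruct (Nat.eqb_spec a (a + S j)); [lia|]. f_equal.
    apply map_ext. intros i. now rewrite Nat.add_succ_comm.
Qed.

Lemma upd_tup (n j : nat) (s : nat -> word) (u : word) :
  upd (tup n s) j (eval u) = tup n (ovr s j u).
Proof.
  unfold tup. rewrite upd_map_seq. apply map_ext. intros i. unfold ovr. simpl.
  now destruct (i =? j).
Qed.

Lemma eval_app_fun (u v : word) : eval (u ++ v) = fun x => eval u (eval v x).
Proof. extensionality x. apply eval_app. Qed.

Lemma inverse_of_rev (w : word) : inverse_of (eval (rev w)) (eval w).
Proof. split; intros x; rewrite <- eval_app; [apply rev_mul | apply mul_rev]. Qed.

Lemma inverse_of_eval (g : tfun) (w : word) : inverse_of g (eval w) -> g = eval (rev w).
Proof.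
  intros (_ & H). extensionality x. rewrite <- (H x) at 2. symmetry.
  destruct (inverse_of_rev w) as (K & _). apply K.
Qed.

Lemma gclos_eval (S : list tfun) (H : word -> Prop) :
  subgroup H -> (forall f, In f S -> exists w, H w /\ f = eval w) ->
  forall f, gclos S f -> exists w, H w /\ f = eval w.
Proof.
  intros SH HS f G. induction G as [|f I|f g _ (u & Hu & ->) _ (v & Hv & ->)|f g _ (u & Hu & ->) I].
  - exists []. split; [now apply sub1 | reflexivity].
  - auto.
  - exists (u ++ v). split; [now apply subM|]. symmetry. apply eval_app_fun.
  - exists (rev u). split; [now apply subV|]. now apply inverse_of_eval.
Qed.

Lemma gclos_subgroup (S : list tfun) : subgroup (fun w => gclos S (eval w)).
Proof.
  split.
  - apply gc_id.
  - intros u v Hu Hv. rewrite eval_app_fun. now apply gc_mul.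
  - intros u Hu. apply (gc_inv _ (eval u)); auto. apply inverse_of_rev.
  - intros u v E Hu. apply eval_weq in E. now rewrite <- E.
Qed.

Lemma Grig_eval (f : tfun) : Grig f <-> exists w, f = eval w.
Proof.
  split.
  - intros G. destruct (gclos_eval [ga; gb; gc; gd] (fun _ => True)) with (f := f) as (w & _ & E); eauto.
    + now split.
    + intros g [<- | [<- | [<- | [<- | []]]]];
        [exists [La] | exists [Lb] | exists [Lc] | exists [Ld]]; auto.
  - intros (w & ->). revert w. apply (full_of_gens _ (gclos_subgroup _)).
    intros x. apply gc_gen. destruct x; simpl; auto.
Qed.

Lemma gen_tuple_tup (n : nat) (s : nat -> word) : Full n s -> gen_tuple n (tup n s).
Proof.
  intros F. split; [unfold tup; now rewrite length_map, length_seq|].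
  intros f. split.
  - intros G. apply Grig_eval.
    destruct (gclos_eval (tup n s) (fun _ => True)) with (f := f) as (w & _ & E); eauto.
    + now split.
    + intros g I. apply in_map_iff in I. destruct I as (i & <- & _). eauto.
  - intros G. apply Grig_eval in G. destruct G as (w & ->). specialize (F w). revert w F.
    apply (generated_least _ _ _ (gclos_subgroup _)). intros i Hi. apply gc_gen.
    rewrite <- (nth_tup n i s (fun x => x)) by auto. apply nth_In.
    unfold tup. now rewrite length_map, length_seq.
Qed.

Lemma gen_tuple_words (n : nat) (v : list tfun) :
  gen_tuple n v -> exists s, v = tup n s /\ Full n s.
Proof.
  intros (L & G).
  assert (W : exists ws, v = map eval ws).
  { assert (A : forall f, In f v -> exists w, f = eval w).
    { intros f I. apply Grig_eval, G, gc_gen, I. }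
    clear - A. induction v as [|f v IH]; [now exists []|].
    destruct (A f (or_introl eq_refl)) as (w & ->).
    destruct IH as (ws & ->); [intros; apply A; now right|]. now exists (w :: ws). }
  destruct W as (ws & ->). rewrite length_map in L. exists (fun i => nth i ws []).
  assert (E : map eval ws = tup n (fun i => nth i ws [])).
  { apply (nth_ext _ _ (eval []) (eval [])).
    - unfold tup. now rewrite !length_map, length_seq.
    - intros i Hi. rewrite length_map in Hi. rewrite nth_tup by lia. apply map_nth. }
  split; auto. intros w.
  destruct (gclos_eval (map eval ws) (generated (fun i => i < n) (fun i => nth i ws [])))
    with (f := eval w) as (u & Hu & Eu).
  - apply generated_subgroup.
  - intros f I. rewrite E in I. apply in_map_iff in I. destruct I as (i & <- & I).
    apply in_seq in I. exists (nth i ws []). split; auto.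
    apply (gen_g _ (fun i => nth i ws [])). lia.
  - apply G, Grig_eval. now exists w.
  - apply (gen_E _ _ u); auto. now apply eval_weq.
Qed.

Lemma pr_edge_act1 (n : nat) (m : move) (s : nat -> word) :
  valid n m -> pr_edge n (tup n s) (tup n (act1 s m)).
Proof.
  destruct m as [[[i j] b] l]. intros (Hi & Hj & N). exists i, j. splits; auto.
  exists (eval (if b then rev (s i) else s i)).
  rewrite !nth_tup by auto. split.
  - destruct b; auto using inverse_of_rev.
  - rewrite <- !eval_app_fun, !upd_tup. destruct l; auto.
Qed.

Lemma walk_act (n : nat) (ms : list move) (s : nat -> word) :
  Full n s -> Forall (valid n) ms -> walk n (tup n s) (tup n (act ms s)) (length ms).
Proof.
  intros F. induction ms as [|m ms IH] using rev_ind; intros V; [constructor|].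
  apply Forall_app in V. destruct V as [V Vm]. inversion Vm; subst.
  unfold act. rewrite fold_left_app, length_app, Nat.add_1_r. simpl.
  apply (walkS _ _ (tup n (act ms s))); auto.
  - now apply pr_edge_act1.
  - apply gen_tuple_tup. apply Full_act1; auto. apply (Full_conn n s); auto.
    exists ms. split; auto. apply agree_refl.
Qed.

Theorem connected (n : nat) : 4 <= n -> connected_PR n.
Proof.
  intros Hn v w Gv Gw.
  destruct (gen_tuple_words n v Gv) as (s & -> & F).
  destruct (gen_tuple_words n w Gw) as (s' & -> & F').
  destruct (conn_all n s s' Hn F F') as (ms & V & A).
  exists (length ms). rewrite <- (tup_agree _ _ _ A). now apply walk_act.
Qed.

(** * Growth *)

Definition cntA (w : word) : nat := length (filter isA w).

(* The elements (ab)^2 moved to the vertices 1^t, by words whose length only doubles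
   because a alternates with the other letters. *)
Definition deep (t : nat) : word := Nat.iter t lift1 abab.

Lemma lift1_length (w : word) :
  length (lift1 w) = length w + 2 * cntA w /\ cntA (lift1 w) = 2 * cntA w.
Proof.
  induction w as [|x w (IH1 & IH2)]; auto. simpl lift1. unfold cntA in *.
  rewrite length_app, filter_app, length_app, IH1, IH2. destruct x; simpl; lia.
Qed.

Lemma deep_length (t : nat) : length (deep t) = 4 * 2 ^ t.
Proof.
  enough (length (deep t) = 4 * 2 ^ t /\ cntA (deep t) = 2 * 2 ^ t) by tauto.
  induction t as [|t (IH1 & IH2)]; [auto|]. change (deep (S t)) with (lift1 (deep t)).
  destruct (lift1_length (deep t)) as [-> ->]. rewrite IH1, IH2. simpl. lia.
Qed.

(** The section at 0 of [lift1 w] is the image of w under a -> d, b -> 1, c, d -> a: the dihedral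
    quotient with a and d exchanged. So w sits at bit 1 alone as soon as it dies in that
    quotient. *)
Lemma lift1_types (w : word) :
  q1 (lift1 w) = xorb (rt w) (dpar w) /\ q2 (lift1 w) = q1 w /\
  sec (lift1 w) false == ad_nf (dpar w) (rt w) (xorb (zpar w) (rt w && dpar w)).
Proof.
  assert (A : Forall (fun x => x = La \/ x = Ld) (sec (lift1 w) false)).
  { induction w as [|x w IH]; [constructor|]. simpl. rewrite sec_app, rt_lift1.
    apply Forall_app. split; auto. destruct x; simpl; auto. }
  assert (Q : q1 (lift1 w) = xorb (rt w) (dpar w) /\ q2 (lift1 w) = q1 w).
  { clear A. unfold dpar. induction w as [|x w (IH1 & IH2)]; [now split|].
    simpl lift1. rewrite q1_app, q2_app, IH1, IH2.
    destruct x; simpl; destruct (rt w), (q1 w), (q2 w); now split. }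
  destruct Q as (Q1 & Q2). splits; auto. rewrite (ad_nf_spec _ A).
  pose proof (zpar_swap (lift1 w) true) as I5.
  destruct (sec_types (lift1 w) true) as (I1 & I2 & I3 & _).
  rewrite sec_lift1 in *. simpl in *. unfold dpar at 1.
  rewrite I1, I2, I3, I5, Q1, Q2. unfold dpar.
  destruct (rt w), (q1 w), (q2 w); reflexivity.
Qed.

Lemma deep_loc (t : nat) : loc (repeat true t) abab (deep t).
Proof.
  assert (T : forall t, rt (deep t) = false /\ q1 (deep t) = false /\ q2 (deep t) = false /\
                zpar (deep t) = false).
  { clear. induction t as [|t (T0 & T1 & T2 & T3)]; [now splits|].
    change (deep (S t)) with (lift1 (deep t)).
    destruct (lift1_types (deep t)) as (Q1 & Q2 & E).
    rewrite rt_lift1, zpar_sec, Q1, Q2. destruct (weq_types _ _ E) as (_ & _ & ->).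
    unfold dpar. now rewrite T0, T1, T2, T3. }
  induction t as [|t IH]; [simpl; reflexivity|].
  change (deep (S t)) with (lift1 (deep t)). simpl. rewrite rt_lift1, sec_lift1.
  destruct (lift1_types (deep t)) as (_ & _ & E). destruct (T t) as (T0 & T1 & T2 & T3).
  splits; auto. rewrite E. unfold dpar. rewrite T0, T1, T2, T3. reflexivity.
Qed.

(** * Hamiltonian paths and products of disjoint conjugates *)

Fixpoint traj (v : vtx) (l : word) : list vtx :=
  match l with [] => [v] | x :: l' => v :: traj (gen_act x v) l' end.

(* A letter that acts as x on s at the vertex e :: s, where e = 0 if x = a and 1 otherwise. *)
Definition up (x : gen) : gen :=
  match x with La => Lc | Lb => Ld | Lc => Lb | Ld => Lc end.

Definition double (l : word) : word := flat_map (fun x => [La; up x]) l ++ [La].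

(* Hamiltonian paths from 1^t in the Schreier graphs of the levels (Gray code). *)
Fixpoint gray (t : nat) : word := match t with 0 => [] | S t' => double (gray t') end.

Fixpoint alt (e : bool) (l : word) : Prop :=
  match l with [] => True | x :: l' => isA x = e /\ alt (negb e) l' end.

Lemma alt_double (l : word) : alt true (double l) .
Proof.
  induction l as [|x l IH]; [simpl; auto|]. unfold double in *. simpl. splits; auto.
  now destruct x.
Qed.

Lemma traj_head (v : vtx) (l : word) : In v (traj v l).
Proof. destruct l; simpl; auto. Qed.

(** The letter a visits the sibling above v, then [up x] moves v and keeps the first bit.
    Alternation of l makes this bit the one at which [up x] acts as x. *)
Lemma traj_double (l : word) (e : bool) (v : vtx) :
  alt e l -> NoDup (traj v l) ->
  NoDup (traj (e :: v) (double l)) /\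
  forall u, In u (traj (e :: v) (double l)) -> exists f u', u = f :: u' /\ In u' (traj v l).
Proof.
  revert e v; induction l as [|x l IH]; intros e v A N.
  - simpl. split.
    + constructor; [|constructor; [simpl; tauto | constructor]].
      intros [E | []]. injection E as E. now destruct e.
    + intros u [<- | [<- | []]]; eauto.
  - destruct A as (Ax & A). simpl in N. inversion N as [|? ? Nv N' E]; subst.
    assert (S : gen_act (up x) (negb (isA x) :: v) = negb (isA x) :: gen_act x v).
    { rewrite gen_act_cons. destruct x; reflexivity. }
    destruct (IH (negb (isA x)) (gen_act x v) A N') as (D & I).
    unfold double in *. cbn [flat_map app]. cbn [traj].
    change (gen_act La (isA x :: v)) with (negb (isA x) :: v). rewrite S.
    assert (Nf : forall f, ~ In (f :: v) (traj (negb (isA x) :: gen_act x v)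
                   (flat_map (fun x => [La; up x]) l ++ [La]))).
    { intros f J. destruct (I _ J) as (f' & u' & Eu & Iu). injection Eu as <- <-. auto. }
    split.
    + constructor; [|constructor; auto].
      intros [E | J]; [injection E as E; now destruct (isA x) | now apply (Nf (isA x))].
    + intros u [<- | [<- | J]].
      * exists (isA x), v. split; auto. now left.
      * exists (negb (isA x)), v. split; auto. now left.
      * destruct (I u J) as (f & u' & -> & Iu). exists f, u'. split; auto. now right.
Qed.

Lemma gray_spec (t : nat) :
  alt true (gray t) /\ NoDup (traj (repeat true t) (gray t)) /\ S (length (gray t)) = 2 ^ t.
Proof.
  induction t as [|t (A & N & L)].
  - simpl. splits; auto. constructor; [simpl; auto | constructor].
  - simpl gray. splits; [apply alt_double | now apply traj_double |].
    simpl. rewrite <- L. unfold double. rewrite length_app. simpl.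
    assert (E : forall l, length (flat_map (fun x => [La; up x]) l) = 2 * length l).
    { induction l as [|x l IH]; simpl; lia. }
    rewrite E. lia.
Qed.

Lemma length_gen_act (x : gen) (v : vtx) : length (gen_act x v) = length v.
Proof.
  revert x; induction v as [|e v IH]; intros x; [now rewrite gen_act_nil|].
  rewrite gen_act_cons. simpl. f_equal. unfold gsec.
  destruct (isA x); auto. destruct e; simpl; auto. destruct x; auto; apply (IH La).
Qed.

Lemma loc_eval (v u : vtx) (g w : word) (z : vtx) :
  loc v g w -> length u = length v -> eval w (u ++ z) = if list_eq_dec bool_dec u v then v ++ eval g z else u ++ z.
Proof.
  revert u w; induction v as [|e v IH]; intros [|f u] w L Hl; try discriminate.
  - destruct (list_eq_dec bool_dec [] []); [apply L | congruence].
  - injection Hl as Hl. destruct L as (R & T & L). simpl app. rewrite eval_cons, R, xorb_false_r.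
    destruct (bool_dec f e) as [->|N].
    + rewrite (IH u (sec w e) L Hl).
      destruct (list_eq_dec bool_dec u v), (list_eq_dec bool_dec (e :: u) (e :: v)); congruence.
    + replace f with (negb e) by (destruct f, e; simpl; congruence). rewrite T.
      destruct (list_eq_dec bool_dec (negb e :: u) (e :: v)) as [E|]; auto.
      injection E. now destruct e.
Qed.

Fixpoint select (y : word) (l : word) (bs : list bool) {struct bs} : word :=
  match bs with
  | [] => []
  | b :: bs' =>
      pw b y ++ match l with [] => [] | x :: l' => select (cj [x] y) l' bs' end
  end.

Lemma select_fix (l : word) (bs : list bool) (y g : word) (v u z : vtx) :
  loc v g y -> length u = length v -> ~ In u (traj v l) ->
  eval (select y l bs) (u ++ z) = u ++ z.
Proof.
  revert l y g v; induction bs as [|b bs IH]; intros l y g v L Hl Nu; auto.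
  cbn [select]. rewrite eval_app.
  assert (E : eval (match l with [] => [] | x :: l' => select (cj [x] y) l' bs end) (u ++ z) = u ++ z).
  { destruct l as [|x l]; auto. simpl in Nu.
    apply (IH l (cj [x] y) (cj (secv [x] v) g) (gen_act x v)).
    - apply (loc_cj v g [x] y L).
    - now rewrite length_gen_act.
    - tauto. }
  transitivity (eval (pw b y) (u ++ z)); [exact (f_equal _ E)|]. destruct b; auto. simpl. rewrite (loc_eval v u g y z L Hl).
  destruct (list_eq_dec bool_dec u v) as [->|]; auto. destruct Nu. apply traj_head.
Qed.

Lemma eval_inj (w : word) (x y : vtx) : eval w x = eval w y -> x = y.
Proof.
  intros E. destruct (inverse_of_rev w) as (K & _). rewrite <- (K x), <- (K y). now rewrite E.
Qed.

(** Below v only the first factor acts, so its bit can be read off there and the factor cancelled; h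
    records the conjugations made so far. *)
Lemma select_inj (l : word) (bs bs' : list bool) (y h : word) (v : vtx) :
  loc v (cj h abab) y -> NoDup (traj v l) ->
  length bs = S (length l) -> length bs' = S (length l) ->
  select y l bs == select y l bs' -> bs = bs'.
Proof.
  revert bs bs' y h v; induction l as [|x l IH]; intros [|b bs] [|b' bs'] y h v L N Hl Hl' E;
    try discriminate.
  (* [abab] moves the vertex 00, so its conjugate by h moves t. *)
  all: set (t := eval h [false; false]).
  all: assert (M : eval (cj h abab) t <> t)
    by (unfold t, cj; rewrite !eval_app; destruct (inverse_of_rev h) as (K & _); rewrite K;
        intros F; apply eval_inj in F; discriminate).
  all: assert (B : forall c, eval (pw c y) (v ++ t) = if c then v ++ eval (cj h abab) t else v ++ t)
    by (intros []; auto; simpl; rewrite (loc_eval v v _ y t L eq_refl);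
        destruct (list_eq_dec bool_dec v v); congruence).
  - destruct bs, bs'; try discriminate. simpl in E. rewrite !app_nil_r in E.
    specialize (E (v ++ t)). rewrite !B in E.
    destruct b, b'; auto; apply app_inv_head in E; congruence.
  - simpl in N, Hl, Hl'. inversion N as [|? ? Nv N' Ev]; subst.
    pose proof (loc_cj v (cj h abab) [x] y L) as L'. rewrite cj_cj in L'.
    assert (F : forall cs, eval (select (cj [x] y) l cs) (v ++ t) = v ++ t).
    { intros cs. apply (select_fix _ _ _ _ _ _ _ L'); auto.
      symmetry. apply length_gen_act. }
    simpl in E. assert (b = b').
    { specialize (E (v ++ t)). rewrite !eval_app, !F, !B in E.
      destruct b, b'; auto; apply app_inv_head in E; congruence. }
    subst b'. f_equal.
    apply (IH _ _ _ _ _ L'); auto.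
    intros z. specialize (E z). rewrite !eval_app in E. now apply eval_inj in E.
Qed.

Definition conn_le (n k : nat) (s s' : nat -> word) : Prop :=
  exists ms, Forall (valid n) ms /\ length ms <= k /\ agree n (act ms s) s'.

Lemma conn_le_trans (n k k' : nat) (s s' s'' : nat -> word) :
  conn_le n k s s' -> conn_le n k' s' s'' -> conn_le n (k + k') s s''.
Proof.
  intros (ms & V & L & A) (ms' & V' & L' & A'). exists (ms ++ ms').
  splits; [now apply Forall_app | rewrite length_app; lia |].
  unfold act. rewrite fold_left_app.
  apply (agree_trans _ _ (act ms' s')); auto. now apply act_agree.
Qed.

Lemma conn_le_agree (n k : nat) (s s' : nat -> word) : agree n s s' -> conn_le n k s s'.
Proof. exists []. splits; auto. simpl. lia. Qed.

Lemma conn_le_mono (n k k' : nat) (s s' : nat -> word) :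
  k <= k' -> conn_le n k s s' -> conn_le n k' s s'.
Proof. intros L (ms & V & L' & A). exists ms. splits; auto. lia. Qed.

(** This is where 5 comes from: three entries keep generators of G available, one carries y and one
    collects w. *)
Definition state (y w : word) (i : nat) : word :=
  match i with 0 => [La] | 1 => [Lc] | 2 => [Ld] | 3 => y | 4 => w | _ => [] end.

Lemma state_agree (n : nat) (y y' w w' : word) :
  y == y' -> w == w' -> agree n (state y w) (state y' w').
Proof. intros Ey Ew [|[|[|[|[|i]]]]] _; simpl; auto; reflexivity. Qed.

Lemma Full_state (n : nat) (y w : word) : 3 <= n -> Full n (state y w).
Proof.
  intros Hn. pose proof (generated_subgroup (fun i => i < n) (state y w)) as SG.
  assert (Ga : generated (fun i => i < n) (state y w) [La]) by (apply (gen_g _ (state y w) 0); lia).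
  assert (Gc : generated (fun i => i < n) (state y w) [Lc]) by (apply (gen_g _ (state y w) 1); lia).
  assert (Gd : generated (fun i => i < n) (state y w) [Ld]) by (apply (gen_g _ (state y w) 2); lia).
  apply full_of_gens; auto. intros []; auto.
  apply (subE _ SG ([Lc] ++ [Ld])); [word_eq | now apply subM].
Qed.

Definition attach (left : bool) (x : gen) (y : word) : word :=
  if left then [x] ++ y else y ++ [x].

(** The second move is needed for b = cd, which is not an entry. *)
Lemma state_letter (n : nat) (x : gen) (y w : word) (left : bool) :
  5 <= n -> conn_le n 2 (state y w) (state (attach left x y) w).
Proof.
  intros Hn.
  assert (S1 : forall i u y, i < 3 -> state y w i = [u] ->
    conn_le n 1 (state y w) (state (attach left u y) w)).
  { clear y. intros i u y Hi E. exists [(i, 3, false, left)].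
    splits; auto; [repeat constructor; simpl; lia|].
    intros k Hk. simpl. rewrite E. unfold attach.
    destruct (Nat.eq_dec k 3) as [->|N]; [rewrite ovr_eq; simpl; reflexivity|].
    rewrite ovr_neq by auto. destruct k as [|[|[|[|[|k]]]]]; try reflexivity. congruence. }
  destruct x.
  - apply (conn_le_mono n 1); auto. apply (S1 0); auto.
  - destruct left.
    + apply (conn_le_trans n 1 1 _ (state (attach true Ld y) w)).
      * apply (S1 2); auto.
      * apply (conn_le_trans n 1 0 _ (state (attach true Lc (attach true Ld y)) w)).
        -- apply (S1 1); auto.
        -- apply conn_le_agree, state_agree; [|reflexivity]. simpl.
           change (Lc :: Ld :: y) with ([Lc; Ld] ++ y). now rewrite klein.
    + apply (conn_le_trans n 1 1 _ (state (attach false Lc y) w)).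
      * apply (S1 1); auto.
      * apply (conn_le_trans n 1 0 _ (state (attach false Ld (attach false Lc y)) w)).
        -- apply (S1 2); auto.
        -- apply conn_le_agree, state_agree; [|reflexivity]. simpl.
           rewrite <- app_assoc. simpl. now rewrite klein.
  - apply (conn_le_mono n 1); auto. apply (S1 1); auto.
  - apply (conn_le_mono n 1); auto. apply (S1 2); auto.
Qed.

Lemma state_word (n : nat) (u y w : word) :
  5 <= n -> conn_le n (2 * length u) (state y w) (state (y ++ u) w).
Proof.
  intros Hn. revert y. induction u as [|x u IH]; intros y.
  - rewrite app_nil_r. apply conn_le_agree, agree_refl.
  - replace (2 * length (x :: u)) with (2 + 2 * length u) by (simpl; lia).
    replace (y ++ x :: u) with (attach false x y ++ u) by (simpl; now rewrite <- app_assoc).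
    eapply conn_le_trans; [|apply IH]. now apply state_letter.
Qed.

Lemma state_collect (n : nat) (b : bool) (y w : word) :
  5 <= n -> conn_le n 1 (state y w) (state y (w ++ pw b y)).
Proof.
  intros Hn. destruct b.
  - exists [(3, 4, false, false)]. splits; auto; [repeat constructor; simpl; lia|].
    intros [|[|[|[|[|i]]]]] _; reflexivity.
  - simpl. rewrite app_nil_r. apply conn_le_agree, agree_refl.
Qed.

(** Each vertex costs one move to collect and two for either side of the conjugation. As y' does not
    depend on bs, entry 4 alone distinguishes the results. *)
Lemma state_select (n : nat) (l y : word) :
  5 <= n -> exists y', forall bs w, length bs = S (length l) ->
  conn_le n (5 * S (length l)) (state y w) (state y' (w ++ select y l bs)).
Proof.
  intros Hn. revert y. induction l as [|x l IH]; intros y.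
  - exists y. intros [|b [|? ?]] w Hl; try discriminate. simpl. rewrite app_nil_r.
    apply (conn_le_mono n 1); [lia|]. now apply state_collect.
  - destruct (IH (cj [x] y)) as (y' & C). exists y'. intros [|b bs] w Hl; try discriminate.
    replace (5 * S (length (x :: l))) with (1 + (2 + (2 + 5 * S (length l)))) by (simpl; lia).
    cbn [select]. rewrite app_assoc.
    apply (conn_le_trans _ _ _ _ _ _ (state_collect n b y w Hn)).
    apply (conn_le_trans _ _ _ _ _ _ (state_letter n x y _ true Hn)).
    apply (conn_le_trans _ _ _ _ _ _ (state_letter n x _ _ false Hn)).
    apply (C bs). simpl in Hl. congruence.
Qed.

Lemma ball_of_conn_le (n k : nat) (s s' : nat -> word) :
  Full n s -> conn_le n k s s' -> ball n (tup n s) k (tup n s').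
Proof.
  intros F (ms & V & L & A). rewrite <- (tup_agree _ _ _ A). split.
  - apply gen_tuple_tup, (Full_conn n s); auto. exists ms. split; auto. apply agree_refl.
  - exists (length ms). split; auto. now apply walk_act.
Qed.

Fixpoint bitlists (k : nat) : list (list bool) :=
  match k with
  | 0 => [[]]
  | S k' => map (cons true) (bitlists k') ++ map (cons false) (bitlists k')
  end.

Lemma bitlists_spec (k : nat) :
  length (bitlists k) = 2 ^ k /\ NoDup (bitlists k) /\
  forall bs, In bs (bitlists k) -> length bs = k.
Proof.
  induction k as [|k (L & N & I)].
  - simpl. splits; auto; [constructor; simpl; auto; constructor|]. intros bs [<- | []]; auto.
  - simpl bitlists. splits.
    + rewrite length_app, !length_map, L. simpl. lia.
    + apply NoDup_app.
      * apply NoDup_map_NoDup_ForallPairs; auto. intros x y _ _ E. now injection E.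
      * apply NoDup_map_NoDup_ForallPairs; auto. intros x y _ _ E. now injection E.
      * intros bs H K. apply in_map_iff in H, K. destruct H as (x & <- & _).
        destruct K as (y & E & _). discriminate.
    + intros bs H. apply in_app_or in H.
      destruct H as [H | H]; apply in_map_iff in H; destruct H as (x & <- & H); simpl; auto.
Qed.

(** 13 = 2 * 4 + 5: two moves for each of the 4 * 2^t letters of [deep t], and five for each of the
    2^t vertices. *)
Lemma ball_large (n t r : nat) :
  5 <= n -> 13 * 2 ^ t <= r ->
  exists l, NoDup l /\ (forall v, In v l -> ball n (tup n (state [] [])) r v) /\
    length l = 2 ^ 2 ^ t.
Proof.
  intros Hn Hr. destruct (gray_spec t) as (_ & N & L).
  destruct (state_select n (gray t) (deep t) Hn) as (y' & C).
  set (f bs := tup n (state y' ([] ++ select (deep t) (gray t) bs))).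
  destruct (bitlists_spec (2 ^ t)) as (BL & BN & BI).
  exists (map f (bitlists (2 ^ t))). splits.
  - apply NoDup_map_NoDup_ForallPairs; auto. intros bs bs' I I' E.
    apply BI in I, I'.
    apply (select_inj (gray t) bs bs' (deep t) [] (repeat true t)); auto; try congruence.
    + apply (loc_ext _ abab _ (deep t)); [reflexivity | reflexivity | apply deep_loc].
    + apply eval_weq.
      assert (E4 := f_equal (fun v => nth 4 v (fun x => x)) E). unfold f in E4. cbv beta in E4.
      now rewrite !nth_tup in E4 by lia.
  - intros v I. apply in_map_iff in I. destruct I as (bs & <- & I). apply BI in I.
    apply ball_of_conn_le; [apply Full_state; lia|].
    apply (conn_le_mono n (2 * length (deep t) + 5 * S (length (gray t)))).
    + rewrite deep_length, L. lia.
    + apply (conn_le_trans _ _ _ _ (state (deep t) [])).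
      * apply (state_word n (deep t) [] []); auto.
      * apply C. congruence.
  - now rewrite length_map.
Qed.

Lemma root_of_two (k : nat) : k <> 0 -> exists alpha : R, (1 < alpha)%R /\ (alpha ^ k = 2)%R.
Proof.
  intros Hk. exists (Rpower 2 (/ INR k)).
  assert (0 < INR k)%R by (apply lt_0_INR; lia).
  split.
  - rewrite <- (Rpower_O 2) by lra. apply Rpower_lt; [lra|]. now apply Rinv_0_lt_compat.
  - rewrite <- Rpower_pow by (apply exp_pos). rewrite Rpower_mult.
    rewrite Rinv_l by lra. apply Rpower_1. lra.
Qed.

Lemma exp_growth_state (n : nat) : 5 <= n -> exp_growth_from n (tup n (state [] [])).
Proof.
  (* For the largest t with 13 * 2^t <= r one has r < 26 * 2^t, so the 26th root of 2 serves as
     growth rate. *)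
  intros Hn. destruct (root_of_two 26) as (alpha & Ha & Hp); [lia|].
  exists alpha. split; auto. exists 13. intros r Hr.
  assert (Hq : 1 <= r / 13) by (apply Nat.div_le_lower_bound; lia).
  set (t := Nat.log2 (r / 13)).
  destruct (Nat.log2_spec (r / 13)) as (T1 & T2); [lia|]. fold t in T1, T2.
  assert (D : r = 13 * (r / 13) + r mod 13) by (apply Nat.div_mod; lia).
  assert (M : r mod 13 < 13) by (apply Nat.mod_upper_bound; lia).
  rewrite Nat.pow_succ_r' in T2.
  destruct (ball_large n t r Hn) as (l & N & B & L); [lia|].
  exists l. splits; auto. rewrite L, pow_INR.
  apply Rle_trans with (alpha ^ (26 * 2 ^ t))%R.
  - apply Rle_pow; [lra | lia].
  - rewrite pow_mult, Hp. simpl. apply Rle_refl.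
Qed.

Theorem theorem5p3 : forall n : nat, (5 <= n)%nat -> PR_exp_growth n.
Proof.
  intros n Hn. split; [apply connected; lia|].
  exists (tup n (state [] [])). split.
  - apply gen_tuple_tup, Full_state. lia.
  - now apply exp_growth_state.
Qed.
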